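(* Let $\alpha>1$ and let $Z_\alpha:=\{z\in \mathbb{C}: |\operatorname{Re} z|^\alpha<\operatorname{Im} z\}$. Then there exists a parabolic semigroup $(\phi_t)$ of $\mathbb{D}$ such that $\phi_t$ does not converge non-tangentially to its Denjoy-Wolff point as $t\to+\infty$ (that is, for $z\in\mathbb{D}$ the trajectory $\phi_t(z)$ does not converge non-tangentially to the Denjoy-Wolff point), and such that, if $h$ is its Koenigs function, then $Z_\alpha\subset h(\mathbb{D})$.
   Context: $\mathbb{D}=\{z\in\mathbb{C}:|z|<1\}$. A semigroup in $\mathbb{D}$ is a family $(\phi_t)_{t\ge0}$ of holomorphic self-maps of $\mathbb{D}$ with $\phi_0=\mathrm{id}$, $\phi_{s+t}=\phi_s\circ\phi_t$, and $t\mapsto\phi_t$ continuous for uniform convergence on compacta. If it is not a group of hyperbolic rotations, there is a unique $\tau\in\overline{\mathbb{D}}$, the Denjoy-Wolff point, with $\lim_{t\to+\infty}\phi_t(z)=\tau$ for all $z\in\mathbb{D}$. The semigroup is non-elliptic if $\tau\in\partial\mathbb{D}$; it is parabolic if it is non-elliptic and the angular derivative of $\phi_t$ at $\tau$ equals $1$ for all $t\ge 0$. The Koenigs function of a non-elliptic semigroup is a univalent (injective holomorphic) function $h:\mathbb{D}\to\mathbb{C}$ with $h(\phi_t(z))=h(z)+it$ for all $t\ge0$, $z\in\mathbb{D}$, such that $\bigcup_{t\ge0}(h(\mathbb{D})-it)$ is either $\mathbb{C}$, or a half-plane bounded by a vertical line, or a vertical strip; it is essentially unique. The case where this union is $\mathbb{C}$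 is exactly the case of parabolic semigroups of zero hyperbolic step. A trajectory $\phi_t(z)$ converges non-tangentially to $\tau\in\partial\mathbb{D}$ as $t\to+\infty$ if it converges to $\tau$ and there is $A>1$ such that $|\tau-\phi_t(z)|<A(1-|\phi_t(z)|)$ for all $t$ large enough. *)

(* Defs.v *)
From mathcomp Require Import all_boot all_order all_algebra.
From mathcomp Require Import complex.
From mathcomp Require Import all_classical all_reals all_analysis.

Set Implicit Arguments.
Unset Strict Implicit.
Unset Printing Implicit Defensive.

Import Order.TTheory GRing.Theory Num.Theory.
Import numFieldNormedType.Exports.
Local Open Scope classical_set_scope.
Local Open Scope complex_scope.
Local Open Scope ring_scope.

(* R[i] carries no topology by itself; its regular module R[i]^o is a normed
   module over the field R[i].  Hence the modulus `|z| is a (real) element of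
   R[i], reals are compared with it through %:C, and [derivable f z 1] is
   complex differentiability. *)
Notation Cplx R := (complex R)^o.

Section ComplexSemigroups.
Variable R : realType.
Local Notation C := (Cplx R).

Definition unit_disc : set C := [set z | `|z| < 1].

Definition holomorphic_on_disc (f : C -> C) : Prop :=
  forall z, unit_disc z -> derivable f z 1.

(* Only the values at times t >= 0 and at points of the disc are relevant. *)
Definition holomorphic_semigroup (phi : R -> C -> C) : Prop :=
  [/\ forall t : R, 0 <= t -> holomorphic_on_disc (phi t),
      forall (t : R) z, 0 <= t -> unit_disc z -> unit_disc (phi t z),
      forall z, unit_disc z -> phi 0 z = z,
      forall (s t : R) z, 0 <= s -> 0 <= t -> unit_disc z ->
        phi (s + t) z = phi s (phi t z)
    & forall K : set C, compact K -> K `<=` unit_disc ->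
      forall t : R, 0 <= t ->
        {uniform K, phi @ within [set s | 0 <= s] (nbhs t) --> phi t}].

(* The point attracting all the trajectories; a group of hyperbolic rotations
   has none. *)
Definition denjoy_wolff_point (phi : R -> C -> C) (tau : C) : Prop :=
  `|tau| <= 1 /\
  forall z, unit_disc z -> phi t z @[t --> +oo] --> tau.

Definition nonelliptic_semigroup (phi : R -> C -> C) (tau : C) : Prop :=
  [/\ holomorphic_semigroup phi, denjoy_wolff_point phi tau & `|tau| = 1].

(* For A > 0, a subset of the unit disc, since `|tau - z| >= 0. *)
Definition stolz (tau : C) (A : R) : set C :=
  [set z | `|tau - z| < A%:C * (1 - `|z|)].

Definition angular_limit (f : C -> C) (tau l : C) : Prop :=
  forall A : R, 1 < A -> f @ within (stolz tau A) (nbhs tau) --> l.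

(* eta is the angular limit of f at tau, i.e. the boundary value f(tau). *)
Definition angular_derivative (f : C -> C) (tau l : C) : Prop :=
  exists eta : C, angular_limit f tau eta /\
    angular_limit (fun z => (f z - eta) / (z - tau)) tau l.

Definition parabolic_semigroup (phi : R -> C -> C) (tau : C) : Prop :=
  nonelliptic_semigroup phi tau /\
  forall t : R, 0 <= t -> angular_derivative (phi t) tau 1.

Definition converges_nontangentially (gamma : R -> C) (tau : C) : Prop :=
  gamma t @[t --> +oo] --> tau /\
  exists2 A : R, 1 < A & \forall t \near +oo, stolz tau A (gamma t).

Definition koenigs_normalized (U : set C) : Prop :=
  [\/ U = setT,
      exists a : R, U = [set w : C | a < complex.Re w]
                    \/ U = [set w : C | complex.Re w < a]
    | exists a b : R, a < b /\ U = [set w : C | a < complex.Re w < b]].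

(* A predicate on h, because the Koenigs function is unique only up to an
   additive constant. *)
Definition koenigs_function (phi : R -> C -> C) (h : C -> C) : Prop :=
  [/\ holomorphic_on_disc h,
      {in unit_disc &, injective h},
      forall (t : R) z, 0 <= t -> unit_disc z -> h (phi t z) = h z + 'i%C * t%:C
    & koenigs_normalized
        (\bigcup_(t in [set t : R | 0 <= t])
           [set w - 'i%C * t%:C | w in h @` unit_disc])].

Definition Zset (alpha : R) : set C :=
  [set z | `|complex.Re z| `^ alpha < complex.Im z].

End ComplexSemigroups.

(* Main.v *)
Require Import Defs.
From mathcomp Require Import all_boot all_order all_algebra.
From mathcomp Require Import complex ring lra.
From mathcomp Require Import all_classical all_reals all_analysis.

Set Implicit Arguments.
Unset Strict Implicit.
Unset Printing Implicit Defensive.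

Import Order.TTheory GRing.Theory Num.Theory.
Import numFieldNormedType.Exports.
Local Open Scope classical_set_scope.
Local Open Scope complex_scope.
Local Open Scope ring_scope.

(** Let U be the upper half-plane. The Koenigs function is, up to the Cayley
    transform from the disc to U sending 1 to infinity,

      h = - i (zeta log zeta + c)      (zeta in U, c a real constant),

    so that phi_t is conjugated to zeta log zeta |-> zeta log zeta - t. With
    w = log zeta, which ranges over the strip 0 < Im w < pi, one has
    zeta log zeta = w exp w, and everything reduces to this map.

    - It is injective on the strip and its image, described by [spiral_dom], is
      invariant under translations to the left. Writing w = m + iv, one
      eliminates m from w exp w = X + iY; the remaining equation [phase X Y v = 0]
      has a strictly monotone left-hand side ([phase_incr]), whose signs at the
      ends of the admissible interval decide solvability ([spiral_dom_sol],
      [spiral_sol_dom]). The same monotonicity shows that the inverse is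
      continuous ([unspiral_near]), hence holomorphic ([cdiff_unspiral]).

    - Every point of the plane enters the image after a translation to the left
      ([spiral_dom_down]), so the translates of h(D) fill the plane.

    - On the left of the imaginary axis h(D) is bounded by a curve of the form
      y = (|x| / pi) ln (|x| / pi) - c. It grows more slowly than |x| ^ alpha for
      every alpha > 1, so Z_alpha lies in h(D) as soon as c is large
      ([spiral_dom_power]). It also grows faster than any linear function, and
      the domain contains the right half-plane; seen from far away, h(D) looks
      like that half-plane and vertical half-lines run along its boundary.
      This is why orbits are tangential. Quantitatively, m tends to +oo along
      an orbit while Y = exp m (m sin v + v cos v) stays constant, so
      the sine of v = arg zeta tends to 0 ([spiral_tangential]).

    - The orbit of w moves by a bounded amount in time t when Re w is large
      ([flow_close]); then phi_t(zeta) / zeta tends to 1 as zeta tends to infinity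
      ([flow_ratio_cvg]), which says that the angular derivative at 1 is 1. *)

(** * Limits of real and complex valued functions *)

Section ModulusLimits.
Variable R : realType.
Local Notation C := (Cplx R).
Local Notation Re := (@complex.Re R).
Local Notation Im := (@complex.Im R).
Local Notation I := ('i%C : C).

(** The limit rules are stated for pointwise expressions and an explicit
    [fmap f F], so that they apply to the neighbourhood filters of C without
    unfolding them. *)
Section CvgRealOps.
Context (T : Type) (F : set_system T) {FF : Filter F}.
Implicit Types (f g : T -> R) (a b : R).

Lemma cvgRD f g a b : fmap f F --> a -> fmap g F --> b ->
  fmap (fun x => f x + g x) F --> a + b.
Proof. exact: cvgD. Qed.

Lemma cvgRB f g a b : fmap f F --> a -> fmap g F --> b ->
  fmap (fun x => f x - g x) F --> a - b.
Proof. exact: cvgB. Qed.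

Lemma cvgRM f g a b : fmap f F --> a -> fmap g F --> b ->
  fmap (fun x => f x * g x) F --> a * b.
Proof. exact: cvgM. Qed.

Lemma cvgRV f a : a != 0 -> fmap f F --> a -> fmap (fun x => (f x)^-1) F --> a^-1.
Proof. by move=> a0 fa; apply: cvgV. Qed.

Lemma cvgR_cst a : fmap (fun=> a) F --> a.
Proof. exact: cvg_cst. Qed.

Lemma cvgR_norm f a : fmap f F --> a -> fmap (fun x => `|f x|) F --> `|a|.
Proof. exact: cvg_norm. Qed.

Lemma cvgR_comp (h : R -> R) f a : {for a, continuous h} -> fmap f F --> a ->
  fmap (fun x => h (f x)) F --> h a.
Proof. by move=> ch fa; apply: (cvg_comp _ _ fa ch). Qed.

Lemma cvgR_near_eq f g a : (\forall x \near F, f x = g x) ->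
  fmap f F --> a -> fmap g F --> a.
Proof. by move=> fg; apply: cvg_trans; apply: near_eq_cvg. Qed.

Lemma cvgR_gt f a c : fmap f F --> a -> c < a -> \forall x \near F, c < f x.
Proof. by move=> fa; exact: cvgr_gt fa c. Qed.

Lemma cvgR_lt f a c : fmap f F --> a -> a < c -> \forall x \near F, f x < c.
Proof. by move=> fa; exact: cvgr_lt fa c. Qed.

Lemma cvgR_squeeze0 f g : (\forall x \near F, `|f x| <= g x) ->
  fmap g F --> (0 : R) -> fmap f F --> (0 : R).
Proof.
move=> fg /cvgrPdist_lt g0; apply/cvgrPdist_lt => e e0; near=> x.
have h1 : `|f x| <= g x by near: x; exact: fg.
have h2 : `|0 - g x| < e by near: x; exact: g0.
rewrite sub0r normrN (le_lt_trans h1)// (le_lt_trans _ h2)//.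
by rewrite sub0r normrN ler_norm.
Unshelve. all: by end_near. Qed.

Lemma cvgR_dist f a : (forall e, 0 < e -> \forall x \near F, `|a - f x| < e) ->
  fmap f F --> a.
Proof. by move=> h; apply/cvgrPdist_lt. Qed.

End CvgRealOps.

Definition cmod (z : C) : R := Num.sqrt (Re z ^+ 2 + Im z ^+ 2).

Lemma normCE (z : C) : `|z| = (cmod z)%:C.
Proof. exact: normc_def. Qed.

Lemma cmod_ge0 z : 0 <= cmod z. Proof. exact: sqrtr_ge0. Qed.

Lemma cmodM (z w : C) : cmod (z * w) = cmod z * cmod w.
Proof. by apply: complexI; rewrite rmorphM /= -!normCE normrM. Qed.

Lemma cmodV (z : C) : cmod z^-1 = (cmod z)^-1.
Proof. by apply: complexI; rewrite fmorphV /= -!normCE normfV. Qed.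

Lemma cmodD (z w : C) : cmod (z + w) <= cmod z + cmod w.
Proof. by rewrite -lecR rmorphD /= -!normCE ler_normD. Qed.

Lemma cmodN (z : C) : cmod (- z) = cmod z.
Proof. by apply: complexI; rewrite -!normCE normrN. Qed.

Lemma cmod0 : cmod 0 = 0.
Proof. by apply: complexI; rewrite -!normCE normr0. Qed.

Lemma cmod_real (t : R) : cmod t%:C = `|t|.
Proof. by rewrite /cmod /= expr0n addr0 sqrtr_sqr. Qed.

Lemma cmod_I : cmod I = 1.
Proof. by rewrite /cmod /= expr0n expr1n add0r sqrtr1. Qed.

Lemma cmod_eq0 (z : C) : (cmod z == 0) = (z == 0).
Proof. by rewrite -[RHS]normr_eq0 normCE eq_complex /= eqxx andbT. Qed.

Lemma cmod_gt0 (z : C) : (0 < cmod z) = (z != 0).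
Proof. by rewrite lt_neqAle cmod_ge0 andbT eq_sym cmod_eq0. Qed.

Lemma cmod2 (z : C) : cmod z ^+ 2 = Re z ^+ 2 + Im z ^+ 2.
Proof. by rewrite sqr_sqrtr// addr_ge0 ?sqr_ge0. Qed.

Lemma Re_le_cmod (z : C) : `|Re z| <= cmod z.
Proof. by rewrite -sqrtr_sqr ler_wsqrtr// lerDl sqr_ge0. Qed.

Lemma Im_le_cmod (z : C) : `|Im z| <= cmod z.
Proof. by rewrite -sqrtr_sqr ler_wsqrtr// lerDr sqr_ge0. Qed.

Lemma cmod_le (z : C) : cmod z <= `|Re z| + `|Im z|.
Proof.
rewrite -(@ler_pXn2r _ 2) ?nnegrE ?cmod_ge0 ?addr_ge0// cmod2.
rewrite sqrrD !real_normK ?num_real// -addrA lerD2l lerDr.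
by rewrite mulrn_wge0// mulr_ge0.
Qed.

Lemma posC (e : C) : 0 < e -> exists2 r : R, 0 < r & e = r%:C.
Proof.
case: e => a b; rewrite ltcE /= => /andP[/eqP -> a0].
by exists a.
Qed.

Lemma cvgC_ReIm (T : Type) (F : set_system T) {FF : Filter F} (f : T -> C) (l : C) :
  fmap (fun x => Re (f x)) F --> Re l -> fmap (fun x => Im (f x)) F --> Im l ->
  fmap f F --> l.
Proof.
move=> /cvgrPdist_lt hr /cvgrPdist_lt hi; apply/cvgrPdist_lt => e /posC[r r0 ->].
have r2 : 0 < r / 2 by rewrite divr_gt0.
near=> x.
rewrite normCE ltcR (le_lt_trans (cmod_le _))// [ltRHS]splitr ltrD//.
- by rewrite raddfB/=; near: x; exact: hr.
- by rewrite raddfB/=; near: x; exact: hi.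
Unshelve. all: by end_near. Qed.

Lemma cvgC_Re (T : Type) (F : set_system T) {FF : Filter F} (f : T -> C) (l : C) :
  fmap f F --> l -> fmap (fun x => Re (f x)) F --> Re l.
Proof.
move=> /cvgrPdist_lt h; apply/cvgrPdist_lt => e e0; near=> x.
rewrite -raddfB/= (le_lt_trans (Re_le_cmod _))// -ltcR -normCE.
by near: x; apply: h; rewrite ltcR.
Unshelve. all: by end_near. Qed.

Lemma cvgC_Im (T : Type) (F : set_system T) {FF : Filter F} (f : T -> C) (l : C) :
  fmap f F --> l -> fmap (fun x => Im (f x)) F --> Im l.
Proof.
move=> /cvgrPdist_lt h; apply/cvgrPdist_lt => e e0; near=> x.
rewrite -raddfB/= (le_lt_trans (Im_le_cmod _))// -ltcR -normCE.
by near: x; apply: h; rewrite ltcR.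
Unshelve. all: by end_near. Qed.

Lemma cvgC_cmod0 (T : Type) (F : set_system T) {FF : Filter F} (f : T -> C) :
  fmap (fun x => cmod (f x)) F --> (0 : R) -> fmap f F --> (0 : C).
Proof.
move=> /cvgrPdist_lt h; apply/cvgrPdist_lt => e /posC[r r0 ->]; near=> x.
rewrite sub0r normrN normCE ltcR.
have : `|0 - cmod (f x)| < r by near: x; exact: h.
by rewrite sub0r normrN ger0_norm ?cmod_ge0.
Unshelve. all: by end_near. Qed.

Section CvgOps.
Context (T : Type) (F : set_system T) {FF : Filter F}.
Implicit Types (f g : T -> C) (a b : C).

Lemma cvgCD f g a b : fmap f F --> a -> fmap g F --> b ->
  fmap (fun x => f x + g x) F --> a + b.
Proof. exact: cvgD. Qed.

Lemma cvgCB f g a b : fmap f F --> a -> fmap g F --> b ->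
  fmap (fun x => f x - g x) F --> a - b.
Proof. exact: cvgB. Qed.

Lemma cvgCM f g a b : fmap f F --> a -> fmap g F --> b ->
  fmap (fun x => f x * g x) F --> a * b.
Proof. exact: cvgM. Qed.

Lemma cvgCV f a : a != 0 -> fmap f F --> a -> fmap (fun x => (f x)^-1) F --> a^-1.
Proof. by move=> a0 fa; apply: cvgV. Qed.

Lemma cvgC_cst a : fmap (fun=> a) F --> a.
Proof. exact: cvg_cst. Qed.

Lemma cvgC_near_eq f g a : (\forall x \near F, f x = g x) ->
  fmap f F --> a -> fmap g F --> a.
Proof. by move=> fg; apply: cvg_trans; apply: near_eq_cvg. Qed.

Lemma cvgC_neq0 f a : a != 0 -> fmap f F --> a -> \forall x \near F, f x != 0.
Proof. by move=> a0 fa; exact: (cvgr_neq0 _ fa). Qed.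

End CvgOps.

Lemma cvgC_id (z : C) : fmap (fun w => w) (nbhs z) --> z.
Proof. exact: cvg_id. Qed.

End ModulusLimits.

Section ComponentLimits.
Variable R : realType.
Local Notation C := (Cplx R).
Local Notation Re := (@complex.Re R).
Local Notation Im := (@complex.Im R).
Local Notation I := ('i%C : C).

Lemma Re_cvg (z : C) : fmap Re (nbhs z) --> Re z.
Proof. by apply: (@cvgC_Re R _ _ _ (fun w => w)); exact: cvgC_id. Qed.

Lemma Im_cvg (z : C) : fmap Im (nbhs z) --> Im z.
Proof. by apply: (@cvgC_Im R _ _ _ (fun w => w)); exact: cvgC_id. Qed.

Lemma cmod_cvg (z : C) : fmap (@cmod R) (nbhs z) --> cmod z.
Proof.
apply: cvgR_comp; first exact: sqrt_continuous.
by apply: cvgRD; apply: cvgRM; (exact: Re_cvg || exact: Im_cvg).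
Qed.

Lemma cvgC_dist (T : Type) (F : set_system T) {FF : Filter F} (f : T -> C) (a : C) :
  fmap (fun x => cmod (a - f x)) F --> (0 : R) -> fmap f F --> a.
Proof.
move=> /cvgC_cmod0 h.
have : fmap (fun x => a - (a - f x)) F --> a - 0.
  by apply: cvgCB; [exact: cvgC_cst|exact: h].
rewrite subr0; apply: cvgC_near_eq; near=> x; exact: subKr.
Unshelve. all: by end_near. Qed.

Lemma Im_subC (z : C) (t : R) : Im (z - t%:C) = Im z.
Proof. by case: z => a b /=; rewrite subr0. Qed.

Lemma Re_subC (z : C) (t : R) : Re (z - t%:C) = Re z - t.
Proof. by case: z. Qed.

End ComponentLimits.

(** * Complex differentiation by continuous slopes *)

Section Slopes.
Variable R : realType.
Local Notation C := (Cplx R).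
Local Notation Re := (@complex.Re R).
Local Notation Im := (@complex.Im R).
Local Notation I := ('i%C : C).

(** Caratheodory's form of the complex derivative: the slope extends
    continuously to the base point. Chain rule and inversion then amount to
    algebra on slopes, without punctured neighbourhoods. *)
Definition cdiff (f : C -> C) (z l : C) : Prop :=
  exists g : C -> C, [/\ fmap g (nbhs z) --> l, g z = l &
    \forall w \near z, f w - f z = g w * (w - z)].

Lemma cdiff_derivable f z l : cdiff f z l -> derivable f z 1.
Proof.
move=> [g [gl gz fg]]; apply/cvg_ex; exists l.
have sh : h%:A + z @[h --> (0 : C)^'] --> z.
  rewrite -[X in _ --> X]add0r; apply: cvgCD; last exact: cvgC_cst.
  apply: cvg_within_filter.
  have := @scalel_continuous _ C (1 : C) 0; rewrite /continuous_at scale0r.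
  exact.
apply: (@cvg_trans _ (g (h%:A + z) @[h --> (0 : C)^'])); last first.
  exact: cvg_comp sh gl.
apply: near_eq_cvg; near=> h.
have h0 : h != 0 by near: h; exact: nbhs_dnbhs_neq.
have -> : f (h *: 1 + z) - f z = g (h *: 1 + z) * (h *: 1 + z - z).
  near: h; exact: (sh _ fg).
by rewrite addrK [h *: 1]mulr1 [_ *: _]mulrCA mulVf// mulr1.
Unshelve. all: by end_near. Qed.

Lemma cdiff_cvg f z l : cdiff f z l -> fmap f (nbhs z) --> f z.
Proof.
move=> [g [gl gz fg]].
have : fmap (fun w => g w * (w - z) + f z) (nbhs z) --> l * (z - z) + f z.
  apply: cvgCD; last exact: cvgC_cst.
  apply: cvgCM; first exact: gl.
  by apply: cvgCB; [exact: cvgC_id|exact: cvgC_cst].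
rewrite subrr mulr0 add0r; apply: cvgC_near_eq.
near=> w; have <- : f w - f z = g w * (w - z) by near: w; exact: fg.
by rewrite subrK.
Unshelve. all: by end_near. Qed.

Lemma cdiff_comp f g z l m : cdiff f z l -> cdiff g (f z) m ->
  cdiff (g \o f) z (m * l).
Proof.
move=> df; have cf := cdiff_cvg df.
case: df => [p [pl pz fp]] [q [qm qz gq]].
exists (fun w => q (f w) * p w); split.
- by apply: cvgCM; [exact: cvg_comp cf qm|exact: pl].
- by rewrite qz pz.
- have gq' := cf _ gq.
  near=> w => /=.
  have -> : g (f w) - g (f z) = q (f w) * (f w - f z) by near: w; exact: gq'.
  by rewrite -mulrA; congr (_ * _); near: w; exact: fp.
Unshelve. all: by end_near. Qed.

Lemma cdiff_id z : cdiff id z 1.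
Proof.
exists (fun=> 1); split; [exact: cvgC_cst|by []|].
by near=> w; rewrite mul1r.
Unshelve. all: by end_near. Qed.

Lemma cdiffD_cst f z l c : cdiff f z l -> cdiff (fun w => f w + c) z l.
Proof.
move=> [g [gl gz fg]]; exists g; split=> //.
by near=> w; rewrite opprD addrACA subrr addr0; near: w.
Unshelve. all: by end_near. Qed.

Lemma cdiffM f g z l m : cdiff f z l -> cdiff g z m ->
  cdiff (fun w => f w * g w) z (l * g z + f z * m).
Proof.
move=> df dg; have cg := cdiff_cvg dg.
case: df => [p [pl pz fp]]; case: dg => [q [qm qz gq]].
exists (fun w => p w * g w + f z * q w); split.
- apply: cvgCD; apply: cvgCM; [exact: pl|exact: cg|exact: cvgC_cst|exact: qm].
- by rewrite qz pz.
- near=> w.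
  have e1 : f w - f z = p w * (w - z) by near: w.
  have e2 : g w - g z = q w * (w - z) by near: w.
  have -> : f w * g w - f z * g z = (f w - f z) * g w + f z * (g w - g z) by ring.
  by rewrite e1 e2; ring.
Unshelve. all: by end_near. Qed.

Lemma cdiffZ f z l c : cdiff f z l -> cdiff (fun w => c * f w) z (c * l).
Proof.
move=> [p [pl pz fp]]; exists (fun w => c * p w); split.
- by apply: cvgCM; [exact: cvgC_cst|exact: pl].
- by rewrite pz.
- by near=> w; rewrite -mulrBr -mulrA; congr (_ * _); near: w.
Unshelve. all: by end_near. Qed.

(** As [k] is supposed continuous, its slope is the inverse of the slope of
    [f] along [k]. *)
Lemma cdiff_inv f k z l : cdiff f z l -> l != 0 -> k (f z) = z ->
  fmap k (nbhs (f z)) --> z -> (\forall w \near f z, f (k w) = w) ->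
  cdiff k (f z) l^-1.
Proof.
move=> [p [pl pz fp]] l0 kz kc fk.
have pk : fmap (fun w => p (k w)) (nbhs (f z)) --> l by apply: cvg_comp kc pl.
exists (fun w => (p (k w))^-1); split.
- exact: cvgCV.
- by rewrite kz pz.
- have fp' := kc _ fp.
  near=> w; rewrite kz.
  have pn : p (k w) != 0.
    by near: w; exact: cvgC_neq0 l0 pk.
  have fw : f (k w) = w by near: w; exact: fk.
  have : f (k w) - f z = p (k w) * (k w - z) by near: w; exact: fp'.
  by rewrite fw => ->; rewrite mulrA mulVf// mul1r.
Unshelve. all: by end_near. Qed.

Lemma cdiffV (f : C -> C) z l : cdiff f z l -> f z != 0 ->
  cdiff (fun w => (f w)^-1) z (- (l / (f z * f z))).
Proof.
move=> df fz0; have cf := cdiff_cvg df; case: df => [p [pl pz fp]].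
exists (fun w => - 1 * (p w / (f w * f z))); split.
- have -> : - (l / (f z * f z)) = - 1 * (l / (f z * f z)) by rewrite mulN1r.
  apply: cvgCM; first exact: cvgC_cst.
  apply: cvgCM; first exact: pl.
  apply: cvgCV; first by rewrite mulf_neq0.
  by apply: cvgCM; [exact: cf|exact: cvgC_cst].
- by rewrite pz mulN1r.
- have nf := cvgC_neq0 fz0 cf.
  near=> w.
  have fw0 : f w != 0 by near: w; exact: nf.
  have e1 : f w - f z = p w * (w - z) by near: w; exact: fp.
  have -> : (f w)^-1 - (f z)^-1 = - 1 * ((f w - f z) / (f w * f z)).
    by field; rewrite fw0 fz0.
  by rewrite e1; field; rewrite fw0 fz0.
Unshelve. all: by end_near. Qed.

(** The slope is extended by the value of the derivative. *)
Lemma real_slope (f : R -> R) (x l : R) : is_derive x 1 f l ->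
  exists p : R -> R, [/\ {for x, continuous p}, p x = l
    & forall y, f y - f x = p y * (y - x)].
Proof.
move=> [df dl].
exists (fun y => if y == x then l else (f y - f x) / (y - x)); split; last first.
- move=> y; case: eqP => [->|/eqP yx]; first by rewrite !subrr mulr0.
  by rewrite divfK// subr_eq0.
- by rewrite eqxx.
have := df; rewrite /derivable => /cvg_ex[l' hl'].
have ll' : l' = l by rewrite -dl /derive; apply/esym/cvg_lim.
rewrite {}ll' in hl'; move/cvgrPdist_lt : hl' => hl'.
rewrite /prop_for /continuous_at eqxx.
apply/cvgrPdist_lt => e e0; have := hl' _ e0.
rewrite near_withinE !near_simpl => /nbhs_ballP[d /= d0 hd].
apply/nbhs_ballP; exists d => //= y; rewrite /ball/= => xy.
case: eqP => [_|/eqP yx]; first by rewrite subrr normr0.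
have := hd (y - x); rewrite /ball/= sub0r normrN distrC => /(_ xy).
rewrite subr_eq0 => /(_ yx).
by rewrite [_ *: 1]mulr1 subrK [_ *: _]mulrC.
Qed.

End Slopes.

(** * The equation w exp w = X + iY in the strip 0 < Im w < pi *)

Section Phase.
Variable R : realType.

Implicit Types X Y v m : R.

(** With z = X + iY, the number z exp (- iv) is [rotx + i roty]. For
    w = m + iv, the equation w exp w = z reads
    z exp (- iv) = (m + iv) exp m. Its imaginary part gives
    exp m = [roty / v], and the real part becomes the scalar equation
    [phase X Y v = 0] in the single unknown v. *)
Definition rotx X Y v := X * cos v + Y * sin v.
Definition roty X Y v := Y * cos v - X * sin v.
Definition phase X Y v := v * (rotx X Y v / roty X Y v) - ln (roty X Y v / v).

Lemma spiral_eq X Y m v : 0 < v ->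
  (expR m * (m * cos v - v * sin v) = X /\
   expR m * (m * sin v + v * cos v) = Y) <->
  [/\ 0 < roty X Y v, phase X Y v = 0 & m = ln (roty X Y v / v)].
Proof.
move=> v0; have cs : cos v ^+ 2 = 1 - sin v ^+ 2 by rewrite cos2sin2.
split.
  move=> [hX hY].
  have yE : roty X Y v = expR m * v.
    by rewrite /roty -hX -hY; ring: cs.
  have xE : rotx X Y v = expR m * m.
    by rewrite /rotx -hX -hY; ring: cs.
  have mE : ln (roty X Y v / v) = m.
    by rewrite yE mulfK ?gt_eqF// expRK.
  split=> //; first by rewrite yE mulr_gt0 ?expR_gt0.
  rewrite /phase mE xE yE; field.
  by rewrite !gt_eqF ?expR_gt0.
move=> [y0 ph mE].
have eE : expR m = roty X Y v / v by rewrite mE lnK// posrE divr_gt0.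
have xE : m = v * (rotx X Y v / roty X Y v).
  by move/eqP: ph; rewrite /phase -mE subr_eq0 => /eqP.
have -> : expR m * (m * cos v - v * sin v) =
   rotx X Y v * cos v - roty X Y v * sin v.
  by rewrite eE [in LHS]xE; field; rewrite !gt_eqF.
have -> : expR m * (m * sin v + v * cos v) =
   rotx X Y v * sin v + roty X Y v * cos v.
  by rewrite eE [in LHS]xE; field; rewrite !gt_eqF.
by rewrite /rotx /roty; split; ring: cs.
Qed.

Lemma is_derive_rotx X Y v : is_derive v 1 (rotx X Y) (roty X Y v).
Proof.
rewrite /rotx /roty; apply: is_derive_eq.
rewrite /GRing.scale /=; ring.
Qed.

Lemma is_derive_roty X Y v : is_derive v 1 (roty X Y) (- rotx X Y v).
Proof.
rewrite /rotx /roty; apply: is_derive_eq.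
rewrite /GRing.scale /=; ring.
Qed.

(** The derivative is a sum of two squares over v: this is what makes the
    solution v unique, and stable under perturbation of X and Y. *)
Lemma is_derive_phase X Y v : 0 < v -> 0 < roty X Y v ->
  is_derive v 1 (phase X Y)
    (((1 + v * (rotx X Y v / roty X Y v)) ^+ 2 + v ^+ 2) / v).
Proof.
move=> v0 y0.
have dx := is_derive_rotx X Y v; have dy := is_derive_roty X Y v.
have yn : roty X Y v != 0 by rewrite gt_eqF.
have vn : id v != 0 :> R by rewrite gt_eqF.
have dyi := is_deriveV yn dy.
have dvi := is_deriveV vn (is_derive_id v 1).
have ry : 0 < roty X Y v / v by rewrite divr_gt0.
have dq := is_deriveM dy dvi.
have dl := @is_derive1_comp R (@ln R) (fun y => roty X Y y / y) v _ _
  (is_derive1_ln ry) dq.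
apply: (is_derive_eq
  (is_deriveB (is_deriveM (is_derive_id v 1) (is_deriveM dx dyi)) dl)).
rewrite /GRing.scale /= -[(rotx X Y * _) v]/(rotx X Y v / roty X Y v).
field.
by rewrite yn vn.
Qed.

Lemma rotx_pi X Y : rotx X Y pi = - X.
Proof. by rewrite /rotx cospi sinpi mulr0 addr0 mulrN1. Qed.

Lemma roty_pi X Y : roty X Y pi = - Y.
Proof. by rewrite /roty cospi sinpi mulr0 subr0 mulrN1. Qed.

(** A sinusoid of frequency one is interpolated by sines; hence [roty] is
    positive between two points at distance less than pi where it is positive. *)
Lemma roty_between X Y a b v :
  sin (b - a) * roty X Y v =
  sin (b - v) * roty X Y a + sin (v - a) * roty X Y b.
Proof.
have ca : cos v ^+ 2 = 1 - sin v ^+ 2 by rewrite cos2sin2.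
have cb : cos a ^+ 2 = 1 - sin a ^+ 2 by rewrite cos2sin2.
have cc : cos b ^+ 2 = 1 - sin b ^+ 2 by rewrite cos2sin2.
rewrite /roty !sinB; ring: ca cb cc.
Qed.

Lemma roty_gt0_itv X Y a b v : 0 <= a -> b <= pi -> b - a < pi ->
  0 < roty X Y a -> 0 < roty X Y b -> a <= v <= b -> 0 < roty X Y v.
Proof.
move=> a0 bpi ba ya yb /andP[]; rewrite le_eqVlt => /orP[/eqP<-//|av].
rewrite le_eqVlt => /orP[/eqP->//|vb].
have sp : 0 < sin (b - a).
  by apply: sin_gt0_pi; rewrite subr_gt0 (lt_trans av vb).
rewrite -(pmulr_rgt0 _ sp) roty_between.
by rewrite addr_gt0// mulr_gt0// sin_gt0_pi// subr_gt0 ?vb ?av/=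
   (le_lt_trans _ ba)// lerB// ltW.
Qed.

Lemma roty_gt0_segment X Y a b : 0 < a -> b <= pi ->
  0 < roty X Y a -> 0 < roty X Y b ->
  forall v, v \in `[a, b]%R -> 0 < v /\ 0 < roty X Y v.
Proof.
move=> a0 bpi ya yb v; rewrite in_itv/= => vab; split.
  by case/andP: vab => av _; exact: lt_le_trans av.
apply: (roty_gt0_itv (ltW a0) bpi _ ya yb vab).
by rewrite (lt_le_trans _ bpi)// ltrBlDr ltrDl.
Qed.

Lemma derivable_phase X Y v : 0 < v -> 0 < roty X Y v ->
  derivable (phase X Y) v 1.
Proof. by move=> v0 yv; have [] := is_derive_phase v0 yv. Qed.

(** Positivity of [roty] at the endpoints propagates to the segment, where the
    derivative of [phase] is therefore defined and positive. *)
Lemma phase_incr X Y a b : 0 < a -> b <= pi -> a < b ->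
  0 < roty X Y a -> 0 < roty X Y b -> phase X Y a < phase X Y b.
Proof.
move=> a0 bpi ab ya yb.
have ypos := roty_gt0_segment a0 bpi ya yb.
have dph v : v \in `[a, b]%R -> derivable (phase X Y) v 1.
  by move=> /ypos[]; exact: derivable_phase.
have inW v : v \in `]a, b[%R -> v \in `[a, b]%R by apply: subset_itv_oo_cc.
apply: (@gtr0_derive1_lt_cc _ (phase X Y) a b).
- by move=> v /inW; exact: dph.
- move=> v /inW/ypos[v0 yv]; have dp := is_derive_phase v0 yv.
  rewrite derive1E derive_val divr_gt0// ltr_wpDl ?sqr_ge0// exprn_gt0//.
- exact: derivable_within_continuous.
- by rewrite in_itv/= lexx ltW.
- by rewrite in_itv/= lexx ltW.
- by [].
Qed.

Lemma phase_zero_uniq X Y u v : 0 < u < pi -> 0 < v < pi ->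
  0 < roty X Y u -> 0 < roty X Y v ->
  phase X Y u = 0 -> phase X Y v = 0 -> u = v.
Proof.
move=> /andP[u0 upi] /andP[v0 vpi] yu yv pu pv.
case: (ltgtP u v) => // [uv|vu].
- by have := phase_incr u0 (ltW vpi) uv yu yv; rewrite pu pv ltxx.
- by have := phase_incr v0 (ltW upi) vu yv yu; rewrite pu pv ltxx.
Qed.

Lemma phase_IVT X Y a b : 0 < a -> a <= b -> b <= pi ->
  0 < roty X Y a -> 0 < roty X Y b ->
  phase X Y a < 0 -> 0 < phase X Y b ->
  exists v, [/\ a < v < b, 0 < roty X Y v & phase X Y v = 0].
Proof.
move=> a0 ab bpi ya yb pa pb.
have ypos := roty_gt0_segment a0 bpi ya yb.
have [||v vab pv] := @IVT R (phase X Y) a b 0 ab.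
- by apply: derivable_within_continuous => v /ypos[]; exact: derivable_phase.
- by rewrite ge_min le_max (ltW pa) (ltW pb) orbT.
exists v; split=> //; last by case: (ypos _ vab).
move: vab; rewrite in_itv/= => /andP[av vb].
rewrite lt_neqAle av lt_neqAle vb !andbT; apply/andP; split.
- by apply: contraTneq pa => ->; rewrite pv ltxx.
- by apply: contraTneq pb => <-; rewrite pv ltxx.
Qed.

End Phase.

Section PhaseSolutions.
Variable R : realType.

Implicit Types X Y v m : R.

Lemma derivable_cvg_right (f : R -> R) (x l : R) :
  derivable f x 1 -> f x = l -> f y @[y --> x^'+] --> l.
Proof.
move=> /derivable1_diffP/differentiable_continuous cf <-.
exact: cvg_at_right_filter.
Qed.

(** Mean value theorem: sin v = v cos c with 0 < c < v, and cos decreases. *)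
Lemma sin_bounds v : 0 < v < pi -> v * cos v < sin v < v.
Proof.
move=> /andP[v0 vpi].
have [|c cv] := @MVT R (@sin R) (@cos R) 0 v v0 (fun x _ => is_derive_sin x).
  by apply: continuous_subspaceT; exact: continuous_sin.
rewrite sin0 !subr0 => sE; move: cv; rewrite in_itv/= => /andP[c0 cv].
have vv : v \in `[0, pi]%R by rewrite in_itv/= !ltW.
have cc : c \in `[0, pi]%R by rewrite in_itv/= !ltW// (lt_trans cv).
have zz : 0 \in `[0, (pi : R)]%R by rewrite in_itv/= lexx pi_ge0.
have c1 : cos v < cos c by rewrite ltr_cos.
have c2 : cos c < 1 by rewrite -[1](@cos0 R) ltr_cos.
by rewrite sE mulrC ltr_pM2r// c1 gtr_pMl.
Qed.

(** As v tends to 0 from the right, [roty X Y v] tends to Y > 0, so the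
    logarithm in [phase] tends to +oo and dominates. *)
Lemma phase_neg_upper X Y b : 0 < Y -> 0 < b ->
  exists a, [/\ 0 < a, a < b, 0 < roty X Y a & phase X Y a < 0].
Proof.
move=> Y0 b0.
have d1 : roty X Y a @[a --> 0^'+] --> Y.
  apply: derivable_cvg_right; first by apply: ex_derive; exact: is_derive_roty.
  by rewrite /roty cos0 sin0 mulr1 mulr0 subr0.
have d2 : a * rotx X Y a @[a --> 0^'+] --> (0 : R).
  apply: (@derivable_cvg_right (fun a => a * rotx X Y a)); last by rewrite mul0r.
  have dx := is_derive_rotx X Y 0.
  exact: derivableM.
have Y2 : 0 < Y / 2 by rewrite divr_gt0.
have Y2Y : Y / 2 < Y by lra.
have Ye : 0 < Y / 2 / expR 1 by rewrite divr_gt0// expR_gt0.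
near (0 : R)^'+ => a.
have a0 : 0 < a by near: a; exact: nbhs_right_gt.
have ab : a < b by near: a; exact: nbhs_right_lt.
have ya : Y / 2 < roty X Y a by near: a; exact: cvgr_gt d1 _ Y2Y.
have xa : a * rotx X Y a < Y / 2 by near: a; exact: cvgr_lt d2 _ Y2.
have ae : a < Y / 2 / expR 1 by near: a; exact: nbhs_right_lt.
have y0 : 0 < roty X Y a by apply: lt_trans ya.
exists a; split=> //.
rewrite /phase subr_lt0 (@lt_trans _ _ 1)//.
  by rewrite mulrA ltr_pdivrMr// mul1r (lt_trans xa).
rewrite -[ltLHS](@expRK R) ltr_ln ?posrE ?expR_gt0 ?divr_gt0//.
rewrite ltr_pdivlMr// mulrC.
by move: ae; rewrite ltr_pdivlMr ?expR_gt0// => ae; apply: lt_trans ya.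
Unshelve. all: by end_near. Qed.

(** Here theta is the argument of X + iY, where [roty] vanishes. Just below
    theta, [rotx / roty] is a positive cotangent and the logarithm is negative. *)
Lemma phase_pos_near_arg (rho theta : R) : 0 < rho -> 0 < theta <= pi ->
  let X := rho * cos theta in let Y := rho * sin theta in
  exists b, [/\ 0 < b, b < theta, 0 < roty X Y b & 0 < phase X Y b].
Proof.
move=> r0 /andP[t0 tpi] X Y.
(* ensures d < pi / 2 and rho sin d < theta - d *)
pose d := Num.min (theta / 3) (theta / (3 * rho)).
have d0 : 0 < d by rewrite lt_min !divr_gt0// mulr_gt0.
have d1 : d <= theta / 3 by rewrite ge_min lexx.
have d2 : rho * d <= theta / 3.
  have -> : theta / 3 = rho * (theta / (3 * rho)) by field; rewrite gt_eqF.
  by rewrite ler_pM2l// ge_min lexx orbT.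
have pi0 := pi_gt0 R.
have yE : roty X Y (theta - d) = rho * sin d.
  rewrite /roty /X /Y sinB cosB; have := cos2sin2 theta => cs; ring: cs.
have xE : rotx X Y (theta - d) = rho * cos d.
  rewrite /rotx /X /Y sinB cosB; have := cos2sin2 theta => cs; ring: cs.
have dpi : 0 < d < pi by apply/andP; split; lra.
have sd : 0 < sin d by apply: sin_gt0_pi.
have cd : 0 < cos d by apply: cos_gt0_pihalf; lra.
have /andP[_ sdd] := sin_bounds dpi.
exists (theta - d); split; [lra|lra|by rewrite yE mulr_gt0|].
have b0 : 0 < theta - d by lra.
rewrite /phase xE yE subr_gt0 (@lt_trans _ _ 0)//.
  rewrite ln_lt0// divr_gt0 ?mulr_gt0//= ltr_pdivrMr// mul1r.
  rewrite (@lt_trans _ _ (rho * d)) ?ltr_pM2l//; lra.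
by rewrite mulr_gt0// divr_gt0// mulr_gt0.
Qed.

Lemma polar X Y : 0 < Y ->
  let rho := Num.sqrt (X ^+ 2 + Y ^+ 2) in let theta := acos (X / rho) in
  [/\ 0 < rho, 0 < theta < pi, -1 < X / rho < 1,
      X = rho * cos theta & Y = rho * sin theta].
Proof.
move=> Y0 rho theta.
have r0 : 0 < rho by rewrite sqrtr_gt0 ltr_wpDl ?sqr_ge0// exprn_gt0.
have r2 : rho ^+ 2 = X ^+ 2 + Y ^+ 2 by rewrite sqr_sqrtr// addr_ge0// sqr_ge0.
have q1 : (X / rho) ^+ 2 < 1.
  by rewrite exprMn exprVn ltr_pdivrMr ?exprn_gt0// mul1r r2 ltrDl exprn_gt0.
have q2 : -1 < X / rho < 1.
  by apply/andP; split; move: q1; generalize (X / rho) => q q1; nra.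
have q3 : -1 <= X / rho <= 1 by case/andP: q2 => /ltW-> /ltW->.
case/andP: (q2) => qa qb.
have cE : cos theta = X / rho by rewrite acosK// in_itv/=.
split=> //.
- by rewrite acos_gt0 ?acos_ltpi// ?(ltW qa) ?(ltW qb) ?andbT.
- by rewrite cE mulrC divfK ?gt_eqF.
- rewrite sin_acos//.
  have -> : 1 - (X / rho) ^+ 2 = (Y / rho) ^+ 2.
    rewrite !expr_div_n r2; field.
    by rewrite -r2 sqrf_eq0 gt_eqF.
  by rewrite sqrtr_sqr gtr0_norm ?divr_gt0// mulrC divfK ?gt_eqF.
Qed.

(** For Y < 0 the argument is theta + pi, and [roty] becomes positive just
    above theta. There [phase] is the difference of - a cot d and the logarithm
    of a small number, with d = a - theta; the cotangent wins, since
    ln u <= 2 sqrt u. *)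
Lemma phase_neg_lower (X Y rho theta : R) : 0 < rho -> 0 < theta < pi ->
  X = - (rho * cos theta) -> Y = - (rho * sin theta) ->
  exists a, [/\ 0 < a, a < pi, 0 < roty X Y a & phase X Y a < 0].
Proof.
move=> r0 /andP[t0 tpi] -> ->.
set X' := - _; set Y' := - _.
have ct : (theta + d) * rho * cos d ^+ 2 - 4 * sin d @[d --> (0:R)^'+] --> theta * rho.
  apply: (@derivable_cvg_right (fun d => (theta + d) * rho * cos d ^+ 2 - 4 * sin d)).
    exact: ex_derive.
  by rewrite cos0 sin0 addr0 expr1n mulr1 mulr0 subr0.
have tr0 : 0 < theta * rho by rewrite mulr_gt0.
near (0 : R)^'+ => d.
have d0 : 0 < d by near: d; exact: nbhs_right_gt.
have dt : d < pi - theta by near: d; apply: nbhs_right_lt; rewrite subr_gt0.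
have dpi2 : d < pi / 2 by near: d; apply: nbhs_right_lt; rewrite divr_gt0// pi_gt0.
have main : 0 < (theta + d) * rho * cos d ^+ 2 - 4 * sin d.
  by near: d; exact: cvgr_gt ct _ tr0.
have cs := cos2sin2 theta.
have yE : roty X' Y' (theta + d) = rho * sin d.
  rewrite /roty /X' /Y' sinD cosD; ring: cs.
have xE : rotx X' Y' (theta + d) = - (rho * cos d).
  rewrite /rotx /X' /Y' sinD cosD; ring: cs.
have pi0 := pi_gt0 R.
have sd : 0 < sin d by apply: sin_gt0_pi; apply/andP; split; lra.
have cd : 0 < cos d by apply: cos_gt0_pihalf; apply/andP; split; lra.
have a0 : 0 < theta + d by lra.
exists (theta + d); split; [lra|lra|by rewrite yE mulr_gt0|].
set a := theta + d in a0 main yE xE *.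
set u := a / (rho * sin d).
have u0 : 0 < u by rewrite divr_gt0// mulr_gt0.
have lnu : - ln (roty X' Y' a / a) < 2 * Num.sqrt u.
  rewrite yE -[_ / a]invf_div lnV ?posrE// opprK -/u -{1}[u]sqr_sqrtr ?ltW//.
  rewrite lnXn ?sqrtr_gt0// mulr2n.
  by have := @ln_sublinear R (Num.sqrt u); rewrite sqrtr_gt0 => /(_ u0); lra.
rewrite /phase.
apply: (@lt_trans _ _ (a * (rotx X' Y' a / roty X' Y' a) + 2 * Num.sqrt u)).
  by rewrite ltrD2l.
rewrite xE yE addrC -ltrBrDr sub0r -mulrN mulNr opprK.
have -> : a * (rho * cos d / (rho * sin d)) = a * cos d / sin d.
  by field; rewrite !gt_eqF.
have k0 : 0 < a * cos d / sin d by rewrite divr_gt0// mulr_gt0.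
rewrite -(@ltr_pXn2r _ 2) ?nnegrE ?(ltW k0) ?mulr_ge0 ?sqrtr_ge0//.
rewrite exprMn sqr_sqrtr ?(ltW u0)// /u !exprMn exprVn.
rewrite -subr_gt0.
have -> : a ^+ 2 * cos d ^+ 2 * sin d ^- 2 - 2 ^+ 2 * (a / (rho * sin d)) =
  a / (rho * sin d ^+ 2) * (a * rho * cos d ^+ 2 - 4 * sin d).
  by field; rewrite !gt_eqF.
by rewrite mulr_gt0// divr_gt0// mulr_gt0// exprn_gt0.
Unshelve. all: by end_near. Qed.

(** On the negative real axis [phase] tends to - 1 - ln (- X) as v tends to 0,
    which is where the tip X = - 1/e of the slit comes from. *)
Lemma phase_neg_axis X b : expR 1 * X < -1 -> 0 < b -> b <= pi ->
  exists a, [/\ 0 < a, a < b, 0 < roty X 0 a & phase X 0 a < 0].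
Proof.
move=> Xe b0 bpi.
have e0 := expR_gt0 (1 : R).
have X0 : X < 0 by rewrite -(pmulr_rlt0 _ e0) (lt_trans Xe)// ltrN10.
have r0 : 0 < - X by rewrite oppr_gt0.
have c1 : - X * cos a - expR (- cos a) @[a --> (0 : R)^'+] --> - X - expR (- 1).
  apply: (@derivable_cvg_right (fun a => - X * cos a - expR (- cos a))).
    exact: ex_derive.
  by rewrite cos0 mulr1.
have l0 : 0 < - X - expR (- 1).
  by rewrite expRN subr_gt0 -[_^-1]mulr1 ltr_pdivrMl// mulrN ltrNr.
near (0 : R)^'+ => a.
have a0 : 0 < a by near: a; exact: nbhs_right_gt.
have ab : a < b by near: a; exact: nbhs_right_lt.
have api2 : a < pi / 2 by near: a; apply: nbhs_right_lt; rewrite divr_gt0// pi_gt0.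
have main : 0 < - X * cos a - expR (- cos a).
  by near: a; exact: cvgr_gt c1 _ l0.
have pi0 := pi_gt0 R.
have api : 0 < a < pi by apply/andP; split; lra.
have sa : 0 < sin a by apply: sin_gt0_pi.
have ca : 0 < cos a by apply: cos_gt0_pihalf; apply/andP; split; lra.
have /andP[s1 s2] := sin_bounds api.
have yE : roty X 0 a = - X * sin a by rewrite /roty mul0r sub0r mulNr.
have xE : rotx X 0 a = X * cos a by rewrite /rotx mul0r addr0.
have y0 : 0 < - X * sin a by rewrite mulr_gt0.
exists a; split=> //; first by rewrite yE.
have lnb : - cos a < ln (- X * sin a / a).
  rewrite -[ltLHS](@expRK R) ltr_ln ?posrE ?expR_gt0 ?divr_gt0//.
  rewrite subr_gt0 in main; apply: (lt_trans main).
  by rewrite -mulrA ltr_pM2l// ltr_pdivlMr// mulrC.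
rewrite /phase xE yE.
have -> : a * (X * cos a / (- X * sin a)) = - (cos a * (a / sin a)).
  by field; rewrite (gt_eqF sa) (lt_eqF X0).
have : cos a < cos a * (a / sin a) by rewrite ltr_pMr// ltr_pdivlMr// mul1r.
lra.
Unshelve. all: by end_near. Qed.

(** The image of the strip 0 < Im w < pi under w exp w. The lower side of the
    strip is folded onto the slit X >= - 1/e of the real axis. The upper side
    w = m + i pi goes to the curve X = - m exp m, Y = - pi exp m, that is
    - Y = pi exp (pi X / Y). *)
Definition spiral_dom X Y : Prop :=
  [\/ 0 < Y, Y = 0 /\ expR 1 * X < -1 | Y < 0 /\ - Y < pi * expR (pi * (X / Y))].

Lemma spiral_dom_shift X Y t : 0 <= t -> spiral_dom X Y -> spiral_dom (X - t) Y.
Proof.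
move=> t0 [Y0|[Y0 XY]|[Y0 XY]]; [exact: Or31|apply: Or32|apply: Or33]; split=> //.
  by apply: le_lt_trans XY; rewrite ler_pM2l ?expR_gt0// gerBl.
apply: (lt_le_trans XY); rewrite ler_pM2l ?pi_gt0// ler_expR ler_pM2l ?pi_gt0//.
by rewrite ler_nM2r ?invr_lt0// gerBl.
Qed.

Lemma spiral_dom_sol X Y : spiral_dom X Y ->
  exists v, [/\ 0 < v < pi, 0 < roty X Y v & phase X Y v = 0].
Proof.
have pi0 := pi_gt0 R.
suff H : spiral_dom X Y -> exists a b, [/\ 0 < a, a <= b, b <= pi &
    [/\ 0 < roty X Y a, 0 < roty X Y b, phase X Y a < 0 & 0 < phase X Y b]].
  move=> /H[a [b [a0 ab bpi [ya yb pa pb]]]].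
  have [v [/andP[av vb] yv pv]] := phase_IVT a0 ab bpi ya yb pa pb.
  by exists v; split=> //; rewrite (lt_trans a0 av) (lt_le_trans vb bpi).
case=> [Y0|[-> XY]|[Y0 XY]].
- have [r0 /andP[t0 tpi] _ XE YE] := polar X Y0.
  have := @phase_pos_near_arg _ _ r0; move=> /(_ (acos (X / Num.sqrt (X ^+ 2 + Y ^+ 2)))).
  rewrite t0 (ltW tpi) => /(_ isT) /=; rewrite -XE -YE => -[b [b0 bt yb pb]].
  have [a [a0 ab ya pa]] := phase_neg_upper X Y0 b0.
  by exists a, b; rewrite a0 ltW// (ltW (lt_trans bt tpi)).
- have X0 : X < 0.
    by rewrite -(pmulr_rlt0 _ (expR_gt0 (1:R))) (lt_trans XY)// ltrN10.
  have r0 : 0 < - X by rewrite oppr_gt0.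
  have := @phase_pos_near_arg _ pi r0; rewrite pi0 lexx => /(_ isT) /=.
  rewrite cospi sinpi mulr0 mulrN1 opprK => -[b [b0 bt yb pb]].
  have [a [a0 ab ya pa]] := phase_neg_axis XY b0 (ltW bt).
  by exists a, b; rewrite a0 ltW// ltW.
- have NY : 0 < - Y by rewrite oppr_gt0.
  have [r0 t0 _ XE YE] := polar (- X) NY.
  have [] := @phase_neg_lower X Y _ _ r0 t0; rewrite -?XE -?YE ?opprK//.
  move=> a [a0 api ya pa]; exists a, pi; split=> //; first exact: ltW.
  have yE := roty_pi X Y; have xE := rotx_pi X Y.
  split; rewrite ?yE//.
  rewrite /phase yE xE subr_gt0 invrN mulrNN.
  rewrite -[ltRHS](@expRK R) ltr_ln ?posrE ?expR_gt0 ?divr_gt0//.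
  by rewrite ltr_pdivrMr// mulrC.
Qed.

Lemma spiral_sol_dom X Y v : 0 < v < pi -> 0 < roty X Y v ->
  phase X Y v = 0 -> spiral_dom X Y.
Proof.
move=> /andP[v0 vpi] yv pv; case: (ltgtP Y 0) => [Y0|Y0|Y0]; last 2 first.
- exact: Or31.
- apply: Or32; split=> //; rewrite Y0 in yv pv.
  have sv : 0 < sin v by rewrite sin_gt0_pi ?v0.
  have /andP[s1 s2] : v * cos v < sin v < v by rewrite sin_bounds ?v0.
  have yE : roty X 0 v = - X * sin v by rewrite /roty mul0r sub0r mulNr.
  have xE : rotx X 0 v = X * cos v by rewrite /rotx mul0r addr0.
  have r0 : 0 < - X by move: yv; rewrite yE pmulr_lgt0.
  have : - 1 < ln (- X * sin v / v).
    move: pv; rewrite /phase xE yE => /eqP; rewrite subr_eq0 => /eqP <-.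
    have -> : v * (X * cos v / (- X * sin v)) = - (v * cos v / sin v).
      by field; rewrite (gt_eqF sv) -oppr_eq0 (gt_eqF r0).
    by rewrite ltrN2 ltr_pdivrMr// mul1r.
  rewrite -[ltLHS](@expRK R) ltr_ln ?posrE ?expR_gt0 ?divr_gt0 ?mulr_gt0// => h.
  have h2 : expR (- 1) < - X.
    apply: (lt_trans h); rewrite ltr_pdivrMr// ltr_pM2l//.
  by move: h2; rewrite expRN -[_^-1]mulr1 ltr_pdivrMl ?expR_gt0// mulrN ltrNr.
- apply: Or33; split=> //.
  have NY : 0 < - Y by rewrite oppr_gt0.
  have yE := roty_pi X Y; have xE := rotx_pi X Y.
  have pi0 := pi_gt0 R.
  have := @phase_incr _ X Y v pi v0 (lexx _) vpi yv; rewrite yE => /(_ NY).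
  rewrite pv /phase yE xE subr_gt0 invrN mulrNN.
  rewrite -[ltRHS](@expRK R) ltr_ln ?posrE ?expR_gt0 ?divr_gt0//.
  by rewrite ltr_pdivrMr// mulrC.
Qed.

(** The translates of the domain to the right cover the plane, which is the
    zero hyperbolic step condition. *)
Lemma spiral_dom_down X Y : exists2 t, 0 <= t & spiral_dom (X - t) Y.
Proof.
case: (ltgtP Y 0) => [Y0|Y0|Y0]; last 2 first.
- by exists 0 => //; exact: Or31.
- exists (`|X| + 2); first by rewrite addr_ge0.
  apply: Or32; split=> //.
  have e1 : 1 < expR (1 : R) by rewrite expR_gt1.
  have := ler_norm X; nra.
- have NY : 0 < - Y by rewrite oppr_gt0.
  (* the translation makes the exponent pi (X - t) / Y at least c *)
  pose c := Num.max 0 (ln (- Y / pi) + 1).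
  have c0 : 0 <= c by rewrite le_max lexx.
  exists (`|X| + (- Y) * (c / pi)).
    by rewrite addr_ge0// mulr_ge0 ?divr_ge0 ?pi_ge0// ltW.
  apply: Or33; split=> //.
  rewrite mulrC -ltr_pdivrMr ?pi_gt0// -[ltLHS]lnK ?posrE ?divr_gt0 ?pi_gt0//.
  rewrite ltr_expR.
  have -> : pi * ((X - (`|X| + - Y * (c / pi))) / Y) = pi * ((`|X| - X) / - Y) + c.
    move: (gt_eqF (pi_gt0 R)); move: (c) (pi : R) => c1 p p0; field.
    by rewrite (lt_eqF Y0) p0.
  have : 0 <= pi * ((`|X| - X) / - Y).
    by rewrite mulr_ge0 ?pi_ge0// divr_ge0 ?subr_ge0 ?ler_norm// ltW.
  have : ln (- Y / pi) + 1 <= c by rewrite le_max lexx orbT.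
  lra.
Qed.

(** For x < 0 and s = - x the claim is s ln (s / pi) < pi (y + c). If ln s is at
    most T the left side is bounded, which fixes c. If ln s > T it is at most
    s exp ((alpha - 1) ln s) = s ^ alpha, because exp u >= (u / 2) ^ 2. *)
Lemma spiral_dom_power (alpha : R) : 1 < alpha ->
  exists c, forall x y, `|x| `^ alpha < y -> spiral_dom (- (y + c)) x.
Proof.
move=> a1; pose e := alpha - 1; have e0 : 0 < e by rewrite subr_gt0.
pose T := 4 / e ^+ 2; have T0 : 0 < T by rewrite divr_gt0// exprn_gt0.
have pi2 : 2 <= pi :> R := pi_ge2 R.
have pi0 := pi_gt0 R.
have TE : 0 < T * expR T by rewrite mulr_gt0// expR_gt0.
exists (1 + T * expR T) => x y xy.
have y0 : 0 < y by apply: le_lt_trans xy; exact: powR_ge0.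
case: (ltgtP x 0) => [x0|x0|->]; first last.
- apply: Or32; split=> //.
  have e1 : 1 < expR (1 : R) by rewrite expR_gt1.
  nra.
- exact: Or31.
apply: Or33; split=> //.
have s0 : 0 < - x by rewrite oppr_gt0.
move: xy; rewrite ltr0_norm// => xy; set s := - x in s0 xy *.
have -> : - (y + (1 + T * expR T)) / x = (y + (1 + T * expR T)) / s.
  by rewrite /s invrN mulNr mulrN.
rewrite mulrC -ltr_pdivrMr// -[ltLHS]lnK ?posrE ?divr_gt0//.
rewrite ltr_expR.
have lns : ln (s / pi) <= ln s.
  by rewrite ler_ln ?posrE ?divr_gt0// ler_pdivrMr// ler_peMr ?(ltW s0)//; lra.
apply: (le_lt_trans lns); rewrite mulrA ltr_pdivlMr//.
have sE : s = expR (ln s) by rewrite lnK.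
case: (leP (ln s) T) => [lT|Tl].
  have h : ln s * s <= T * expR T.
    case: (leP (ln s) 0) => l0.
      by rewrite (le_trans _ (ltW TE))// mulr_le0_ge0// ltW.
    rewrite {2}sE ler_pM ?ler_expR ?expR_ge0// ltW//.
  by apply: (le_lt_trans h); nra.
have pE : s `^ alpha = s * expR (e * ln s).
  rewrite /powR gt_eqF// {2}sE -expRD; congr expR; rewrite /e; ring.
have le0 : 0 < ln s by apply: lt_trans Tl.
have h : ln s <= expR (e * ln s).
  have -> : e * ln s = e * ln s / 2 + e * ln s / 2 by field.
  rewrite expRD.
  have := expR_ge1Dx (e * ln s / 2).
  set z := expR _; move=> hz.
  have hz0 : 0 <= e * ln s / 2 by rewrite divr_ge0// mulr_ge0// ltW.
  apply: (@le_trans _ _ ((e * ln s / 2) * (e * ln s / 2))); last first.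
    by rewrite ler_pM//; lra.
  have -> : (e * ln s / 2) * (e * ln s / 2) = ln s * (ln s / T).
    rewrite /T; field; rewrite gt_eqF//.
  by rewrite ler_peMr ?(ltW le0)// ler_pdivlMr// mul1r ltW.
have : ln s * s < y.
  by apply: le_lt_trans xy; rewrite pE mulrC ler_pM2l.
nra.
Qed.

End PhaseSolutions.

(** * Exponential and logarithm *)

Section ExpLog.
Variable R : realType.
Local Notation C := (Cplx R).
Local Notation Re := (@complex.Re R).
Local Notation Im := (@complex.Im R).
Local Notation I := ('i%C : C).

Definition cexp (z : C) : C :=
  (expR (Re z) * cos (Im z)) +i* (expR (Re z) * sin (Im z)).

Lemma cexpD z w : cexp (z + w) = cexp z * cexp w.
Proof.
case: z w => [a b] [c d]; apply/eqP; rewrite eq_complex /=.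
rewrite expRD cosD sinD; apply/andP; split; apply/eqP; ring.
Qed.

Lemma cmod_cexp z : cmod (cexp z) = expR (Re z).
Proof.
rewrite /cmod /cexp /= !exprMn -mulrDr cos2Dsin2 mulr1 sqrtr_sqr.
by rewrite gtr0_norm// expR_gt0.
Qed.

Lemma cexp_neq0 z : cexp z != 0.
Proof. by rewrite -cmod_gt0 cmod_cexp expR_gt0. Qed.

Lemma cexp0 : cexp 0 = 1.
Proof. by rewrite /cexp /= expR0 cos0 sin0 !mul1r. Qed.

(** The slopes of exp, cos and sin at 0 are continuous; splitting exp (a + ib)
    into its components bounds exp w - 1 - w by [K w] times the modulus of w,
    with [K] tending to 0. *)
Lemma cdiff_cexp0 : cdiff cexp 0 1.
Proof.
have [p [cp p0 pE]] := real_slope (is_derive_expR (0 : R)).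
have [q [cq q0 qE]] := real_slope (is_derive_cos (0 : R)).
have [r [cr r0 rE]] := real_slope (is_derive_sin (0 : R)).
rewrite expR0 in p0 pE; rewrite sin0 oppr0 in q0.
rewrite sin0 in rE; rewrite cos0 in r0 qE.
pose K (w : C) : R := expR (Re w) * `|q (Im w)| + `|p (Re w) - 1| +
  `|expR (Re w) * r (Im w) - 1|.
have Re0 := @Re_cvg R 0; have Im0 := @Im_cvg R 0; rewrite /= in Re0 Im0.
have cE : {for 0, continuous (@expR R)} by exact: continuous_expR.
have K0 : fmap K (nbhs (0 : C)) --> (0 : R).
  have -> : (0 : R) = 1 * `|(0 : R)| + `|1 - 1 : R| + `|1 * 1 - 1 : R|.
    by rewrite mulr1 subrr normr0 mulr0 !addr0.
  apply: cvgRD; first apply: cvgRD.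
  - apply: cvgRM; first by rewrite -[1]expR0; exact: cvgR_comp cE Re0.
    by apply: cvgR_norm; rewrite -q0; exact: cvgR_comp cq Im0.
  - apply: cvgR_norm; apply: cvgRB; last exact: cvgR_cst.
    by rewrite -[X in _ --> X]p0; exact: cvgR_comp cp Re0.
  - apply: cvgR_norm; apply: cvgRB; last exact: cvgR_cst.
    apply: cvgRM; first by rewrite -[1]expR0; exact: cvgR_comp cE Re0.
    by rewrite -[X in _ --> X]r0; exact: cvgR_comp cr Im0.
have KE (w : C) : cmod (cexp w - 1 - w) <= K w * cmod w.
  case: w => a b; apply: (le_trans (cmod_le _)); rewrite /K /=.
  have -> : expR a * cos b - 1 - a = expR a * q b * b + (p a - 1) * a.
    have := pE a; have := qE b; rewrite !subr0 => hq hp.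
    by rewrite -mulrA -hq mulrBl -hp mul1r; ring.
  have -> : expR a * sin b - 0 - b = (expR a * r b - 1) * b.
    have := rE b; rewrite !subr0 => hr.
    by rewrite mulrBl -mulrA -hr mul1r.
  have ha := Re_le_cmod (a +i* b); have hb := Im_le_cmod (a +i* b); rewrite /= in ha hb.
  rewrite [leRHS]mulrDl [X in _ <= X + _]mulrDl lerD//; last by rewrite normrM ler_wpM2l.
  apply: (le_trans (ler_normD _ _)); rewrite lerD//.
    by rewrite !normrM (gtr0_norm (expR_gt0 a)) ler_wpM2l// mulr_ge0// expR_ge0.
  by rewrite normrM ler_wpM2l.
exists (fun w => 1 + (cexp w - 1 - w) / w); split.
- rewrite -[X in _ --> X]addr0; apply: cvgCD; first exact: cvgC_cst.
  apply: cvgC_cmod0; apply: cvgR_squeeze0 K0.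
  near=> w; rewrite ger0_norm ?cmod_ge0// cmodM cmodV.
  have [->|w0] := eqVneq w 0.
    by rewrite cmod0 invr0 mulr0 /K !addr_ge0// mulr_ge0// expR_ge0.
  by rewrite ler_pdivrMr ?cmod_gt0.
- by rewrite invr0 mulr0 addr0.
- near=> w; rewrite cexp0 subr0.
  have [->|w0] := eqVneq w 0; first by rewrite mulr0 cexp0 subrr.
  by rewrite mulrDl divfK// mul1r [RHS]addrC subrK.
Unshelve. all: by end_near. Qed.

Lemma cdiff_cexp z : cdiff cexp z (cexp z).
Proof.
have e : cexp = (fun w => cexp z * cexp (w + - z)).
  by apply/funext => w; rewrite -cexpD addrC subrK.
have -> : cdiff cexp z (cexp z) = cdiff (fun w => cexp z * cexp (w + - z)) z (cexp z).
  by rewrite -e.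
rewrite -[X in cdiff _ _ X]mulr1; apply: cdiffZ.
rewrite -[X in cdiff _ _ X]mulr1.
apply: (@cdiff_comp R (fun w => w - z) cexp z 1 1).
  by apply: cdiffD_cst; exact: cdiff_id.
by rewrite subrr; exact: cdiff_cexp0.
Qed.

Definition strip (w : C) := 0 < Im w < pi.

Definition clog (z : C) : C := ln (cmod z) +i* acos (Re z / cmod z).

Lemma clogK z : 0 < Im z -> cexp (clog z) = z.
Proof.
move=> z0; have [r0 _ _ XE YE] := polar (Re z) z0.
apply/eqP; rewrite eq_complex /= lnK ?posrE//.
by rewrite /cmod -XE -YE !eqxx.
Qed.

Lemma clog_strip z : 0 < Im z -> strip (clog z).
Proof. by move=> z0; have [_ + _ _ _] := polar (Re z) z0. Qed.

Lemma cexp_Im_gt0 w : strip w -> 0 < Im (cexp w).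
Proof. by move=> sw; rewrite /= mulr_gt0 ?expR_gt0// sin_gt0_pi. Qed.

Lemma cexp_inj w w' : strip w -> strip w' -> cexp w = cexp w' -> w = w'.
Proof.
move=> /andP[w0 wpi] /andP[v0 vpi] e.
have eR : Re w = Re w'.
  by apply: (@expR_inj R); rewrite -!cmod_cexp e.
apply/eqP; rewrite eq_complex eR eqxx /=; apply/eqP.
apply: cos_inj; rewrite ?in_itv/= ?ltW//.
have := congr1 Re e; rewrite /= eR; apply: mulfI.
by rewrite gt_eqF// expR_gt0.
Qed.

Lemma cexpK w : strip w -> clog (cexp w) = w.
Proof.
move=> sw; have u := cexp_Im_gt0 sw.
by apply: cexp_inj => //; [exact: clog_strip|exact: clogK].
Qed.

Lemma clog_cvg (z : C) : 0 < Im z -> fmap clog (nbhs z) --> clog z.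
Proof.
move=> z0; have [r0 _ q _ _] := polar (Re z) z0.
apply: cvgC_ReIm => /=.
- by apply: cvgR_comp; [exact: continuous_ln|exact: cmod_cvg].
- apply: cvgR_comp; first exact: continuous_acos.
  by apply: cvgRM; [exact: Re_cvg|apply: cvgRV; [rewrite gt_eqF|exact: cmod_cvg]].
Qed.

Lemma Im_gt0_near (z : C) : 0 < Im z -> \forall w \near z, 0 < Im w.
Proof. by move=> z0; exact: (cvgR_gt (@Im_cvg R z) z0). Qed.

Lemma cdiff_clog (z : C) : 0 < Im z -> cdiff clog z z^-1.
Proof.
move=> z0; have e := clogK z0.
have := @cdiff_inv R cexp clog (clog z) (cexp (clog z)).
rewrite e; apply.
- by rewrite -{2}e; exact: cdiff_cexp.
- by rewrite -e cexp_neq0.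
- by [].
- exact: clog_cvg.
- by near=> w; rewrite clogK//; near: w; exact: Im_gt0_near.
Unshelve. all: by end_near. Qed.

End ExpLog.

(** * The map w exp w and its inverse *)

Section SpiralMap.
Variable R : realType.
Local Notation C := (Cplx R).
Local Notation Re := (@complex.Re R).
Local Notation Im := (@complex.Im R).
Local Notation I := ('i%C : C).

Lemma roty_cvg (T : Type) (F : set_system T) {FF : Filter F} (X Y v : T -> R)
    (x y u : R) : fmap X F --> x -> fmap Y F --> y -> fmap v F --> u ->
  fmap (fun t => roty (X t) (Y t) (v t)) F --> roty x y u.
Proof.
move=> hX hY hv; apply: cvgRB; apply: cvgRM => //; apply: cvgR_comp hv.
  exact: continuous_cos.
exact: continuous_sin.
Qed.

Lemma rotx_cvg (T : Type) (F : set_system T) {FF : Filter F} (X Y v : T -> R)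
    (x y u : R) : fmap X F --> x -> fmap Y F --> y -> fmap v F --> u ->
  fmap (fun t => rotx (X t) (Y t) (v t)) F --> rotx x y u.
Proof.
move=> hX hY hv; apply: cvgRD; apply: cvgRM => //; apply: cvgR_comp hv.
  exact: continuous_cos.
exact: continuous_sin.
Qed.

Lemma ln_roty_cvg (T : Type) (F : set_system T) {FF : Filter F} (X Y v : T -> R)
    (x y u : R) : 0 < u -> 0 < roty x y u ->
  fmap X F --> x -> fmap Y F --> y -> fmap v F --> u ->
  fmap (fun t => ln (roty (X t) (Y t) (v t) / v t)) F --> ln (roty x y u / u).
Proof.
move=> u0 yu hX hY hv.
apply: (@cvgR_comp _ _ _ (@ln R) (fun t => roty (X t) (Y t) (v t) / v t)).
  by apply: continuous_ln; rewrite divr_gt0.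
apply: cvgRM; first exact: roty_cvg.
by apply: cvgRV => //; rewrite gt_eqF.
Qed.

Lemma phase_cvg (T : Type) (F : set_system T) {FF : Filter F} (X Y : T -> R)
    (x y u : R) : 0 < u -> 0 < roty x y u ->
  fmap X F --> x -> fmap Y F --> y ->
  fmap (fun t => phase (X t) (Y t) u) F --> phase x y u.
Proof.
move=> u0 yu hX hY; have hu := @cvgR_cst R _ F FF u.
apply: cvgRB; last exact: (@ln_roty_cvg _ F _ X Y (fun=> u)).
apply: cvgRM => //; apply: cvgRM; first exact: (@rotx_cvg _ F _ X Y (fun=> u)).
apply: cvgRV; first by rewrite gt_eqF.
exact: (@roty_cvg _ F _ X Y (fun=> u)).
Qed.

Definition spiral (w : C) : C := w * cexp w.

Lemma spiralE (w z : C) : strip w ->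
  spiral w = z <->
  [/\ 0 < roty (Re z) (Im z) (Im w), phase (Re z) (Im z) (Im w) = 0
    & Re w = ln (roty (Re z) (Im z) (Im w) / Im w)].
Proof.
move=> /andP[v0 vpi]; rewrite -(spiral_eq (Re z) (Im z) (Re w) v0).
case: w z v0 vpi => [m v] [X Y] /= v0 vpi; rewrite /spiral /cexp /=; split.
  by move=> /eqP; rewrite eq_complex /= => /andP[/eqP <- /eqP <-]; split; ring.
move=> [hX hY]; apply/eqP; rewrite eq_complex /= -hX -hY.
by apply/andP; split; apply/eqP; ring.
Qed.

Lemma spiral_inj (w w' : C) : strip w -> strip w' -> spiral w = spiral w' -> w = w'.
Proof.
move=> sw sw' e.
have [y1 p1 m1] := (spiralE (spiral w') sw).1 e.
have [y2 p2 m2] := (spiralE (spiral w') sw').1 erefl.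
have ev := phase_zero_uniq sw sw' y1 y2 p1 p2.
by apply/eqP; rewrite eq_complex ev eqxx andbT m1 m2 ev.
Qed.

Lemma spiral_range (w : C) : strip w -> spiral_dom (Re (spiral w)) (Im (spiral w)).
Proof.
move=> sw; have [y1 p1 _] := (spiralE (spiral w) sw).1 erefl.
exact: spiral_sol_dom y1 p1.
Qed.

Lemma spiral_surj (z : C) : spiral_dom (Re z) (Im z) -> exists2 w, strip w & spiral w = z.
Proof.
move=> /spiral_dom_sol[v [v0 yv pv]].
exists (ln (roty (Re z) (Im z) v / v) +i* v) => //.
by apply/spiralE.
Qed.

(** The branch of the Lambert function with values in the strip. *)
Definition unspiral (z : C) : C := xget 0 [set w | strip w /\ spiral w = z].

Lemma unspiralP (z : C) : spiral_dom (Re z) (Im z) ->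
  strip (unspiral z) /\ spiral (unspiral z) = z.
Proof.
move=> /spiral_surj[w sw wz]; rewrite /unspiral.
by case: xgetP => [w' -> //|/(_ w)]; case.
Qed.

Lemma spiralK (w : C) : strip w -> unspiral (spiral w) = w.
Proof.
move=> sw; have [s e] := unspiralP (spiral_range sw).
exact: spiral_inj.
Qed.

(** [phase] has opposite strict signs at Im w - d and Im w + d. Both signs
    persist for z close to the image of w, so the intermediate value theorem
    locates a preimage of z between these two heights. This gives openness of
    the image and continuity of the inverse together. *)
Lemma unspiral_near (w : C) (e : R) : strip w -> 0 < e ->
  \forall z \near spiral w,
    spiral_dom (Re z) (Im z) /\ `|Im w - Im (unspiral z)| < e.
Proof.
move=> sw e0; have [yw pw _] := (spiralE (spiral w) sw).1 erefl.
set X := Re (spiral w) in yw pw; set Y := Im (spiral w) in yw pw.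
set v := Im w in yw pw *; have /andP[v0 vpi] : 0 < v < pi := sw.
have yc (s : R -> R) : fmap s ((0 : R)^'+) --> v ->
    \forall d \near (0 : R)^'+, 0 < roty X Y (s d).
  move=> sv; apply: cvgR_gt yw.
  by apply: roty_cvg => //; exact: cvgR_cst.
have did : fmap (fun d : R => d) ((0 : R)^'+) --> (0 : R).
  by apply: cvg_at_right_filter; exact: cvg_id.
have nya0 : \forall d \near (0 : R)^'+, 0 < roty X Y (v - d).
  apply: yc; rewrite -[X in _ --> X]subr0; apply: cvgRB => //; exact: cvgR_cst.
have nyb0 : \forall d \near (0 : R)^'+, 0 < roty X Y (v + d).
  apply: yc; rewrite -[X in _ --> X]addr0; apply: cvgRD => //; exact: cvgR_cst.
near (0 : R)^'+ => d.
have d0 : 0 < d by near: d; exact: nbhs_right_gt.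
have de : d < e by near: d; exact: nbhs_right_lt.
have dv : d < v by near: d; exact: nbhs_right_lt.
have dpi : d < pi - v by near: d; apply: nbhs_right_lt; rewrite subr_gt0.
have ya : 0 < roty X Y (v - d) by near: d; exact: nya0.
have yb : 0 < roty X Y (v + d) by near: d; exact: nyb0.
have a0 : 0 < v - d by rewrite subr_gt0.
have b0 : 0 < v + d by rewrite addr_gt0.
have bpi : v + d <= pi by lra.
have av : v - d < v by lra.
have vb : v < v + d by lra.
have pa : phase X Y (v - d) < 0 by rewrite -pw; apply: phase_incr => //; exact: ltW.
have pb : 0 < phase X Y (v + d) by rewrite -pw; apply: phase_incr.
have hX := @Re_cvg R (spiral w); have hY := @Im_cvg R (spiral w).
have ca : fmap (fun=> v - d) (nbhs (spiral w)) --> v - d by exact: cvgR_cst.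
have cb : fmap (fun=> v + d) (nbhs (spiral w)) --> v + d by exact: cvgR_cst.
have nya : \forall z \near spiral w, 0 < roty (Re z) (Im z) (v - d).
  by apply: (cvgR_gt (roty_cvg hX hY ca) ya).
have nyb : \forall z \near spiral w, 0 < roty (Re z) (Im z) (v + d).
  by apply: (cvgR_gt (roty_cvg hX hY cb) yb).
have npa : \forall z \near spiral w, phase (Re z) (Im z) (v - d) < 0.
  by apply: (cvgR_lt (phase_cvg a0 ya hX hY) pa).
have npb : \forall z \near spiral w, 0 < phase (Re z) (Im z) (v + d).
  by apply: (cvgR_gt (phase_cvg b0 yb hX hY) pb).
near=> z.
have za : 0 < roty (Re z) (Im z) (v - d) by near: z; exact: nya.
have zb : 0 < roty (Re z) (Im z) (v + d) by near: z; exact: nyb.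
have qa : phase (Re z) (Im z) (v - d) < 0 by near: z; exact: npa.
have qb : 0 < phase (Re z) (Im z) (v + d) by near: z; exact: npb.
have [u [/andP[u1 u2] yu pu]] := phase_IVT a0 (ltW (lt_trans av vb)) bpi za zb qa qb.
have u0 : 0 < u < pi by rewrite (lt_trans a0 u1) (lt_le_trans u2 bpi).
have dz := spiral_sol_dom u0 yu pu.
split=> //.
have [s sE] := unspiralP dz.
have [y1 p1 _] := (spiralE z s).1 sE.
rewrite (phase_zero_uniq s u0 y1 yu p1 pu) ltr_norml.
by apply/andP; split; lra.
Unshelve. all: by end_near. Qed.

(** The imaginary part is continuous by [unspiral_near]; the real part is an
    explicit continuous function of it. *)
Lemma unspiral_cvg (w : C) : strip w -> fmap unspiral (nbhs (spiral w)) --> w.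
Proof.
move=> sw; have /andP[v0 vpi] := sw.
have [yw pw mw] := (spiralE (spiral w) sw).1 erefl.
have hI : fmap (fun z => Im (unspiral z)) (nbhs (spiral w)) --> Im w.
  apply: cvgR_dist => e e0; have n1 := unspiral_near sw e0; near=> z.
  by have [] : spiral_dom (Re z) (Im z) /\ `|Im w - Im (unspiral z)| < e
    by near: z; exact: n1.
apply: cvgC_ReIm => //.
rewrite mw.
have hX := @Re_cvg R (spiral w); have hY := @Im_cvg R (spiral w).
apply: cvgR_near_eq (ln_roty_cvg v0 yw hX hY hI).
have n1 := unspiral_near sw ltr01.
near=> z.
have [dz _] : spiral_dom (Re z) (Im z) /\ `|Im w - Im (unspiral z)| < 1.
  by near: z; exact: n1.
have [s sE] := unspiralP dz.
by have [_ _ ->] := (spiralE z s).1 sE.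
Unshelve. all: by end_near. Qed.

Lemma cdiff_spiral (w : C) : cdiff spiral w ((1 + w) * cexp w).
Proof.
have := cdiffM (cdiff_id w) (cdiff_cexp w).
by rewrite mulrDl.
Qed.

Lemma spiral_dom_near (w : C) : strip w ->
  \forall z \near spiral w, spiral_dom (Re z) (Im z).
Proof.
move=> sw; have n1 := unspiral_near sw ltr01; near=> z.
have [//] : spiral_dom (Re z) (Im z) /\ `|Im w - Im (unspiral z)| < 1.
by near: z; exact: n1.
Unshelve. all: by end_near. Qed.

Lemma cdiff_unspiral (w : C) : strip w ->
  cdiff unspiral (spiral w) ((1 + w) * cexp w)^-1.
Proof.
move=> sw; apply: cdiff_inv; first exact: cdiff_spiral.
- rewrite mulf_neq0 ?cexp_neq0//.
  apply/eqP => h; have := congr1 Im h; rewrite raddfD/= add0r.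
  by case/andP: sw => /gt_eqF/eqP.
- exact: spiralK.
- exact: unspiral_cvg.
- have n1 := spiral_dom_near sw.
  near=> z; apply: (unspiralP _).2; near: z; exact: n1.
Unshelve. all: by end_near. Qed.

End SpiralMap.

(** * From the disc to the strip *)

Section Cayley.
Variable R : realType.
Local Notation C := (Cplx R).
Local Notation Re := (@complex.Re R).
Local Notation Im := (@complex.Im R).
Local Notation I := ('i%C : C).

Definition cayley (z : C) : C := 2 * I / (1 - z) - I.
Definition cayley_inv (z : C) : C := 1 - 2 * I / (z + I).

Lemma I2_neq0 : 2 * I != 0 :> C.
Proof.
by rewrite mulf_neq0 ?pnatr_eq0// eq_complex /= oner_eq0 andbF.
Qed.

Lemma cmod_lt1 (z : C) : unit_disc z <-> cmod z < 1.
Proof. by rewrite /unit_disc /= normCE -[1]/(1%:C) ltcR. Qed.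

Lemma disc_neq1 (z : C) : unit_disc z -> 1 - z != 0.
Proof.
move=> /cmod_lt1 z1; apply/eqP => /eqP; rewrite subr_eq0 => /eqP z1'.
by move: z1; rewrite -z1' /cmod /= expr1n expr0n addr0 sqrtr1 ltxx.
Qed.

Lemma upper_neqNI (z : C) : 0 < Im z -> z + I != 0.
Proof.
move=> z0; apply/eqP => h; have := congr1 Im h; rewrite raddfD/= => h1; lra.
Qed.

Lemma cayleyK (z : C) : 1 - z != 0 -> cayley_inv (cayley z) = z.
Proof.
move=> z1; rewrite /cayley_inv /cayley subrK invf_div mulrC divfK ?I2_neq0//.
by rewrite subKr.
Qed.

Lemma cayley_invK (z : C) : z + I != 0 -> cayley (cayley_inv z) = z.
Proof.
move=> z1; rewrite /cayley_inv /cayley subKr invf_div mulrC.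
by rewrite divfK ?I2_neq0// addrK.
Qed.

(** The pseudo-hyperbolic identity between the disc and the half-plane. *)
Lemma cmod_cayley_inv (z : C) : z + I != 0 ->
  1 - cmod (cayley_inv z) ^+ 2 = 4 * Im z / cmod (z + I) ^+ 2.
Proof.
move=> z1; have -> : cayley_inv z = (z - I) / (z + I).
  rewrite /cayley_inv; field; exact: z1.
rewrite cmodM cmodV exprMn exprVn.
have n0 : cmod (z + I) ^+ 2 != 0 by rewrite sqrf_eq0 cmod_eq0.
apply: (mulIf n0); rewrite mulrBl !divfK// mul1r !cmod2.
by case: (z) => a b /=; ring.
Qed.

Lemma cayley_upper (z : C) : unit_disc z -> 0 < Im (cayley z).
Proof.
move=> zd; have z1 := disc_neq1 zd.
have c1 : cayley z + I != 0.
  by rewrite /cayley subrK mulf_neq0 ?I2_neq0// invr_eq0.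
have := cmod_cayley_inv c1; rewrite (cayleyK z1) => h.
have : 0 < 1 - cmod z ^+ 2.
  by rewrite subr_gt0 expr_lt1 ?cmod_ge0//; apply/cmod_lt1.
have p : 0 < cmod (cayley z + I) ^+ 2 by rewrite exprn_gt0// cmod_gt0.
by rewrite h ltr_pdivlMr// mul0r pmulr_rgt0.
Qed.

Lemma cayley_inv_disc (z : C) : 0 < Im z -> unit_disc (cayley_inv z).
Proof.
move=> z0; have z1 := upper_neqNI z0; apply/cmod_lt1.
rewrite -(@expr_lt1 _ 2) ?cmod_ge0// -subr_gt0 cmod_cayley_inv//.
by rewrite divr_gt0 ?mulr_gt0 ?exprn_gt0 ?cmod_gt0.
Qed.

(** The conformal map of the disc onto the strip sending 1 to +oo. *)
Definition to_strip (z : C) : C := clog (cayley z).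
Definition of_strip (w : C) : C := cayley_inv (cexp w).

Lemma to_strip_strip z : unit_disc z -> strip (to_strip z).
Proof. by move=> /cayley_upper; exact: clog_strip. Qed.

Lemma of_strip_disc w : strip w -> unit_disc (of_strip w).
Proof. by move=> /cexp_Im_gt0; exact: cayley_inv_disc. Qed.

Lemma to_stripK z : unit_disc z -> of_strip (to_strip z) = z.
Proof.
move=> zd; rewrite /of_strip clogK ?cayley_upper// cayleyK//.
exact: disc_neq1.
Qed.

Lemma of_stripK w : strip w -> to_strip (of_strip w) = w.
Proof.
move=> sw; rewrite /to_strip cayley_invK ?cexpK//.
exact/upper_neqNI/cexp_Im_gt0.
Qed.

Lemma cdiff_to_strip z : unit_disc z -> exists l, cdiff to_strip z l.
Proof.
move=> zd; have z1 := disc_neq1 zd.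
have d0 : cdiff (fun w : C => - 1 * w + 1) z (- 1 * 1).
  by apply: cdiffD_cst; apply: cdiffZ; exact: cdiff_id.
have z1' : - 1 * z + 1 != 0 by rewrite mulN1r addrC.
have d1 := cdiffD_cst (- I) (cdiffZ (2 * I) (cdiffV d0 z1')).
have e : (fun w : C => 2 * I * (- 1 * w + 1)^-1 + - I) = cayley.
  by apply/funext => w; rewrite /cayley mulN1r [- w + 1]addrC.
rewrite e in d1.
eexists; apply: cdiff_comp; first exact: d1.
exact/cdiff_clog/cayley_upper.
Qed.

Lemma cdiff_of_strip w : strip w -> exists l, cdiff of_strip w l.
Proof.
move=> sw; have z1 := upper_neqNI (cexp_Im_gt0 sw).
have d1 := cdiffD_cst 1 (cdiffZ (- (2 * I)) (cdiffV (cdiffD_cst I (cdiff_cexp w)) z1)).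
have e : (fun w : C => - (2 * I) * (cexp w + I)^-1 + 1) = of_strip.
  by apply/funext => u; rewrite /of_strip /cayley_inv mulNr addrC.
by rewrite e in d1; eexists; exact: d1.
Qed.

Lemma cmod_upperD (z : C) : 0 < Im z -> cmod z <= cmod (z + I).
Proof.
move=> z0; rewrite -(@ler_pXn2r _ 2) ?nnegrE ?cmod_ge0// !cmod2.
by rewrite !raddfD/= addr0 lerD2l ler_pXn2r ?nnegrE ?lerDl// ?ltW// ltr_wpDr.
Qed.

Lemma cmod2I : cmod (2 * I) = 2.
Proof.
rewrite cmodM.
rewrite cmod_I.
by rewrite mulr1; apply: complexI; rewrite -normCE normr_nat rmorph_nat.
Qed.

Lemma one_sub_of_strip (w : C) : 1 - of_strip w = 2 * I / (cexp w + I).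
Proof. by rewrite /of_strip /cayley_inv subKr. Qed.

Lemma cmod_one_sub_of_strip (w : C) : strip w ->
  cmod (1 - of_strip w) <= 2 * expR (- Re w).
Proof.
move=> sw; have z0 := cexp_Im_gt0 sw; have z1 := upper_neqNI z0.
rewrite one_sub_of_strip cmodM cmod2I cmodV expRN ler_pM2l//.
rewrite lef_pV2 ?posrE ?cmod_gt0 ?expR_gt0//.
by rewrite -cmod_cexp cmod_upperD.
Qed.

Lemma to_strip_large (M : R) : exists2 d, 0 < d &
  forall z, unit_disc z -> cmod (1 - z) < d -> M < Re (to_strip z).
Proof.
have E0 : 0 < expR M := expR_gt0 M.
exists (2 / (expR M + 1)); first by rewrite divr_gt0// ltr_wpDl// ltW.
move=> z zd zd1; have sw := to_strip_strip zd; have z1 := disc_neq1 zd.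
rewrite -ltr_expR -cmod_cexp clogK ?cayley_upper//.
have : cmod (cayley z + I) <= cmod (cayley z) + cmod I := cmodD _ _.
rewrite cmod_I.
rewrite {1}/cayley subrK cmodM cmod2I cmodV => h.
rewrite -(ltrD2r 1); apply: lt_le_trans h.
rewrite ltr_pdivlMr ?cmod_gt0// mulrC.
by move: zd1; rewrite ltr_pdivlMr// ltr_wpDl// ltW.
Qed.

End Cayley.

(** * The flow on the strip *)

Section Flow.
Variable R : realType.
Local Notation C := (Cplx R).
Local Notation Re := (@complex.Re R).
Local Notation Im := (@complex.Im R).
Local Notation I := ('i%C : C).

Implicit Types (t s M : R) (w z : C).

(** In the strip coordinate, with w exp w as linearizing map. *)
Definition flow t w : C := unspiral (spiral w - t%:C).

Lemma spiral_dom_sub t z : 0 <= t -> spiral_dom (Re z) (Im z) ->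
  spiral_dom (Re (z - t%:C)) (Im (z - t%:C)).
Proof.
by move=> t0 dz; rewrite !raddfB/= subr0; exact: spiral_dom_shift.
Qed.

Lemma flowP t w : 0 <= t -> strip w ->
  strip (flow t w) /\ spiral (flow t w) = spiral w - t%:C.
Proof.
by move=> t0 sw; apply: unspiralP; apply: spiral_dom_sub => //; exact: spiral_range.
Qed.

Lemma flow0 w : strip w -> flow 0 w = w.
Proof. by move=> sw; rewrite /flow subr0 spiralK. Qed.

Lemma flowD s t w : 0 <= s -> 0 <= t -> strip w ->
  flow (s + t) w = flow s (flow t w).
Proof.
move=> s0 t0 sw; have [st et] := flowP t0 sw.
by rewrite /flow -/(flow t w) et rmorphD/= opprD addrAC addrA.
Qed.

Lemma flow_unspiral t w : 0 <= t -> strip w ->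
  (exists l, cdiff (@unspiral R) (spiral w - t%:C) l) /\
  fmap (@unspiral R) (nbhs (spiral w - t%:C)) --> flow t w.
Proof.
move=> t0 sw; have [st et] := flowP t0 sw; rewrite -et; split.
  by eexists; exact: cdiff_unspiral.
exact: unspiral_cvg.
Qed.

Lemma cdiff_flow t w : 0 <= t -> strip w -> exists l, cdiff (flow t) w l.
Proof.
move=> t0 sw; have [[l dl] _] := flow_unspiral t0 sw.
eexists; apply: (@cdiff_comp R (fun u => spiral u - t%:C) (@unspiral R)); last exact: dl.
by apply: cdiffD_cst; exact: cdiff_spiral.
Qed.

Lemma flow_cvg (T : Type) (F : set_system T) {FF : Filter F}
    (r : T -> R) (u : T -> C) t w :
  0 <= t -> strip w -> fmap r F --> t -> fmap u F --> w ->
  fmap (fun x => flow (r x) (u x)) F --> flow t w.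
Proof.
move=> t0 sw rt uw; have [_ c] := flow_unspiral t0 sw.
have h : fmap (fun x => spiral (u x) - (r x)%:C) F --> spiral w - t%:C.
  apply: cvgCB; first exact: cvg_comp uw (cdiff_cvg (cdiff_spiral w)).
  by apply: cvgC_ReIm => //=; exact: cvgR_cst.
exact: cvg_comp h c.
Qed.

Lemma strip_cmod w : strip w -> `|Re w| <= cmod w /\ cmod w <= `|Re w| + 4.
Proof.
move=> /andP[v0 vpi]; split; first exact: Re_le_cmod.
apply: (le_trans (cmod_le w)); rewrite lerD2l gtr0_norm//.
have := @pihalf_lt2 R; lra.
Qed.

Lemma strip_neq0 w : strip w -> w != 0.
Proof.
by move=> /andP[v0 _]; apply: contraTneq v0 => ->; rewrite ltxx.
Qed.

Lemma cmod_spiral w : cmod (spiral w) = cmod w * expR (Re w).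
Proof. by rewrite cmodM cmod_cexp. Qed.

(** The contrapositive is used: orbits have unbounded w exp w, so their real
    part tends to +oo. *)
Lemma cmod_spiral_le w M : strip w -> 0 <= M -> Re w <= M ->
  cmod (spiral w) <= (M + 5) * expR M.
Proof.
move=> /strip_cmod[_ h] M0 wM; rewrite cmod_spiral.
have E0 := expR_gt0 (Re w).
have E1 : expR (Re w) <= expR M by rewrite ler_expR.
have EM : 1 <= expR M by rewrite -expR0 ler_expR.
case: (lerP 0 (Re w)) => w0.
  by rewrite ger0_norm// in h; apply: ler_pM; [exact: cmod_ge0|exact: ltW|lra|exact: E1].
rewrite ltr0_norm// in h.
have h1 : - Re w * expR (Re w) <= 1.
  rewrite -ler_pdivlMr// div1r -expRN (le_trans _ (expR_ge1Dx _))//; lra.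
apply: (@le_trans _ _ ((- Re w + 4) * expR (Re w))); first by rewrite ler_pM2r.
have E3 : expR (Re w) <= 1 by rewrite -expR0 ler_expR ltW.
nra.
Qed.

Lemma flow_growth w M : strip w ->
  \forall t \near +oo, [/\ 0 <= t, strip (flow t w) & M < Re (flow t w)].
Proof.
move=> sw; pose M' := Num.max 0 M.
have M0 : 0 <= M' by rewrite le_max lexx.
have MM : M <= M' by rewrite le_max lexx orbT.
near=> t.
have t0 : 0 <= t by near: t; apply: nbhs_pinfty_ge; rewrite num_real.
have tb : cmod (spiral w) + (M' + 5) * expR M' < t.
  by near: t; apply: nbhs_pinfty_gt; rewrite num_real.
have [s e] := flowP t0 sw; split => //; apply: (le_lt_trans MM).
rewrite ltNge; apply/negP => h.
have := cmod_spiral_le s M0 h; rewrite e => h1.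
have h2 : cmod (t%:C : C) <= cmod (spiral w) + cmod (spiral w - t%:C).
  rewrite -(cmodN (spiral w - t%:C)) opprB; apply: le_trans (cmodD _ _).
  by rewrite addrC subrK.
have h3 : cmod (t%:C : C) = t by rewrite cmod_real ger0_norm.
rewrite h3 in h2; lra.
Unshelve. all: by end_near. Qed.

(** The modulus of w exp w, namely |w| exp (Re w), changes by at most t along
    the flow. For large Re w this forces |Re w' - Re w| <= 1, since changing
    Re w by 1 changes exp (Re w) by a factor greater than 2. *)
Lemma flow_close t w : 0 <= t -> strip w -> 20 <= Re w -> t <= expR (Re w) ->
  cmod (flow t w - w) <= 5.
Proof.
move=> t0 sw m20 tm; have [sf ef] := flowP t0 sw.
have [a1 a2] := strip_cmod sw; have [b1 b2] := strip_cmod sf.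
rewrite ger0_norm in a1 a2; [|lra..].
set w' := flow t w in sf ef b1 b2 *.
have h3 : cmod (t%:C : C) = t by rewrite cmod_real ger0_norm.
have up : cmod (spiral w') <= cmod (spiral w) + t.
  by rewrite ef -{2}h3 -(cmodN t%:C) cmodD.
have lo : cmod (spiral w) <= cmod (spiral w') + t.
  by rewrite ef -{2}h3; apply: le_trans (cmodD _ _); rewrite subrK.
rewrite !cmod_spiral in up lo.
have E0 := expR_gt0 (Re w); have E0' := expR_gt0 (Re w').
have e2 : 2 <= expR (1 : R) by have := expR_ge1Dx (1 : R); lra.
have E1 : 1 <= expR (Re w) by rewrite -expR0 ler_expR; lra.
have dU : Re w' <= Re w + 1.
  rewrite leNgt; apply/negP => h.
  rewrite ger0_norm in b1 b2; [|lra..].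
  have hE : 2 * expR (Re w) <= expR (Re w').
    rewrite (@le_trans _ _ (expR (Re w + 1)))//; last by rewrite ler_expR ltW.
    by rewrite expRD mulrC ler_pM2l.
  have : (Re w + 1) * (2 * expR (Re w)) <= cmod w' * expR (Re w').
    by apply: ler_pM => //; lra.
  nra.
have dL : Re w - 1 <= Re w'.
  rewrite leNgt; apply/negP => h.
  case: (lerP 0 (Re w')) => w0.
    rewrite ger0_norm// in b2.
    have hE : 2 * expR (Re w') <= expR (Re w).
      rewrite (@le_trans _ _ (expR (Re w' + 1)))//; last by rewrite ler_expR; lra.
      by rewrite expRD mulrC ler_pM2l.
    nra.
  have := @cmod_spiral_le w' 0 sf (lexx _) (ltW w0).
  rewrite expR0 cmod_spiral => h1; nra.
apply: (le_trans (cmod_le _)); rewrite !raddfB/=.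
have /andP[v0 vpi] := sw; have /andP[v0' vpi'] := sf.
have pi4 := @pihalf_lt2 R.
have x1 : `|Re w' - Re w| <= 1 by rewrite ler_norml; apply/andP; split; lra.
have x2 : `|Im w' - Im w| <= 4 by rewrite ler_norml; apply/andP; split; lra.
lra.
Qed.

(** With w' the image of w, dividing w' exp w' = w exp w - t by w exp w gives
    exp w' / exp w = (1 - t / (w exp w)) / (1 + (w' - w) / w), and w' - w is
    bounded by [flow_close]. *)
Lemma flow_ratio_cvg (T : Type) (F : set_system T) {FF : Filter F} (u : T -> C) t :
  0 <= t -> (forall M, \forall x \near F, strip (u x) /\ M < Re (u x)) ->
  fmap (fun x => cexp (flow t (u x)) / cexp (u x)) F --> (1 : C).
Proof.
move=> t0 hu.
have n0 : fmap (fun x => (Re (u x))^-1) F --> (0 : R).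
  apply: cvgR_dist => e e0; have h := hu e^-1; near=> x.
  have [_ xe] : strip (u x) /\ e^-1 < Re (u x) by near: x; exact: h.
  have x0 : 0 < Re (u x) by apply: lt_trans xe; rewrite invr_gt0.
  by rewrite sub0r normrN ger0_norm ?invr_ge0 1?ltW// invf_plt ?posrE.
have h1 := hu (20 + t).
have c1 : fmap (fun x => t%:C / spiral (u x)) F --> (0 : C).
  apply: cvgC_cmod0; apply: (@cvgR_squeeze0 _ _ _ _ _ (fun x => t * (Re (u x))^-1)).
    near=> x.
    have [sx xM] : strip (u x) /\ 20 + t < Re (u x) by near: x; exact: h1.
    have [a1 _] := strip_cmod sx; rewrite ger0_norm in a1; last lra.
    rewrite ger0_norm ?cmod_ge0// cmodM cmodV.
    rewrite cmod_real ger0_norm//.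
    rewrite ler_wpM2l// cmod_spiral lef_pV2 ?posrE;
      [|by rewrite mulr_gt0 ?expR_gt0 ?cmod_gt0 ?strip_neq0|lra].
    rewrite (le_trans a1)// ler_peMr ?cmod_ge0// -expR0 ler_expR; lra.
  rewrite -[X in _ --> X](mulr0 t); apply: cvgRM n0; exact: cvgR_cst.
have c2 : fmap (fun x => (flow t (u x) - u x) / u x) F --> (0 : C).
  apply: cvgC_cmod0; apply: (@cvgR_squeeze0 _ _ _ _ _ (fun x => 5 * (Re (u x))^-1)).
    near=> x.
    have [sx xM] : strip (u x) /\ 20 + t < Re (u x) by near: x; exact: h1.
    have [a1 _] := strip_cmod sx; rewrite ger0_norm in a1; last lra.
    rewrite ger0_norm ?cmod_ge0// cmodM cmodV.
    have E := expR_ge1Dx (Re (u x)).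
    apply: ler_pM; rewrite ?cmod_ge0 ?invr_ge0 ?cmod_ge0//.
      by apply: flow_close => //; lra.
    by rewrite lef_pV2 ?posrE ?cmod_gt0 ?strip_neq0//; lra.
  rewrite -[X in _ --> X](mulr0 5); apply: cvgRM n0; exact: cvgR_cst.
have c3 : fmap (fun x => (1 - t%:C / spiral (u x)) /
    (1 + (flow t (u x) - u x) / u x)) F --> (1 : C).
  have e1 : (1 - 0) * (1 + 0)^-1 = 1 :> C by rewrite subr0 addr0 divr1.
  rewrite -[X in _ --> X]e1; apply: cvgCM.
    by apply: cvgCB; [exact: cvgC_cst|exact: c1].
  apply: cvgCV; first by rewrite addr0 oner_neq0.
  by apply: cvgCD; [exact: cvgC_cst|exact: c2].
apply: cvgC_near_eq c3; near=> x.
have [sx _] : strip (u x) /\ 20 + t < Re (u x) by near: x; exact: h1.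
have [sf ef] := flowP t0 sx.
have u0 := strip_neq0 sx; have f0 := strip_neq0 sf; have e0 := cexp_neq0 (u x).
move: ef; rewrite /spiral => ef.
have -> : cexp (flow t (u x)) = (u x * cexp (u x) - t%:C) / flow t (u x).
  by rewrite -ef mulrAC mulfV// mul1r.
field.
by rewrite e0 f0 u0.
Unshelve. all: by end_near. Qed.

End Flow.

(** * The semigroup of the disc *)

Section SpiralSemigroup.
Variable R : realType.
Local Notation C := (Cplx R).
Local Notation Re := (@complex.Re R).
Local Notation Im := (@complex.Im R).
Local Notation I := ('i%C : C).

Implicit Types (t s M : R) (w z : C).

Definition spiral_semigroup t z : C := of_strip (flow t (to_strip z)).
Definition spiral_koenigs (c : R) z : C := - I * (spiral (to_strip z) + c%:C).

Local Notation phi := spiral_semigroup.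

Lemma flow_to_strip t z : 0 <= t -> unit_disc z -> strip (flow t (to_strip z)).
Proof. by move=> t0 zd; have [] := flowP t0 (to_strip_strip zd). Qed.

Lemma to_strip_semigroup t z : 0 <= t -> unit_disc z ->
  to_strip (phi t z) = flow t (to_strip z).
Proof. by move=> t0 zd; rewrite /phi of_stripK//; exact: flow_to_strip. Qed.

Lemma semigroup_joint_cvg t z : 0 <= t -> unit_disc z ->
  fmap (fun x : C * R => phi x.2 x.1)
    (filter_prod (nbhs z) (within [set s : R | 0 <= s] (nbhs t))) --> phi t z.
Proof.
move=> t0 zd; have sz := to_strip_strip zd; have sf := flow_to_strip t0 zd.
have [l dl] := cdiff_of_strip sf; have [l' dl'] := cdiff_to_strip zd.
pose F := filter_prod (nbhs z) (within [set s : R | 0 <= s] (nbhs t)).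
have c1 : fmap (fun x : C * R => to_strip x.1) F --> to_strip z.
  exact: cvg_comp (@cvg_fst _ _ _ _ _) (cdiff_cvg dl').
have c2 : fmap (fun x : C * R => x.2) F --> t.
  apply: cvg_trans (@cvg_snd _ _ _ _ _) _; exact: cvg_within.
exact: cvg_comp (flow_cvg t0 sz c2 c1) (cdiff_cvg dl).
Qed.

(** Joint continuity in (t, z) is uniform over a compact set of z, by the
    near-covering form of compactness. *)
Lemma semigroup_uniform_cvg (K : set C) t : compact K -> K `<=` @unit_disc R ->
  0 <= t -> {uniform K, phi @ within [set s : R | 0 <= s] (nbhs t) --> phi t}.
Proof.
move=> cK KD t0 P /uniform_nbhs[E [entE EP]].
suff : \forall s \near within [set s : R | 0 <= s] (nbhs t),
    K `<=` (fun z => E (phi t z, phi s z)).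
  by apply: filterS => s Ks; apply: EP => y Ky; exact: Ks.
move/compact_near_coveringP : cK; apply.
move=> x Kx; have xd := KD _ Kx.
have cj := semigroup_joint_cvg t0 xd.
have ct : fmap (phi t) (nbhs x) --> phi t x.
  have [l dl] := cdiff_to_strip xd.
  have [l' dl'] := cdiff_flow t0 (to_strip_strip xd).
  have [m dm] := cdiff_of_strip (flow_to_strip t0 xd).
  exact: cdiff_cvg (cdiff_comp (cdiff_comp dl dl') dm).
have sE : entourage (split_ent E) := entourage_split_ent entE.
pose F := filter_prod (nbhs x) (within [set s : R | 0 <= s] (nbhs t)).
have n1 : \forall p \near F, split_ent E (phi t x, phi p.2 p.1).
  have FF : Filter F by apply: filter_prod_filter.
  exact: (@cvg_entourage _ _ (fmap_filter _ FF) _ cj _ sE).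
have n2 : \forall y \near nbhs x, split_ent E (phi t y, phi t x).
  have FF := @nbhs_filter _ x.
  exact: (@cvg_entourage _ _ (fmap_filter _ FF) _ ct _ (entourage_inv sE)).
have n3 : \forall p \near F, split_ent E (phi t p.1, phi t x).
  exact: (@cvg_fst _ _ (nbhs x) (within [set s : R | 0 <= s] (nbhs t)) _ _ n2).
by apply: filterS2 n3 n1 => p /= h3 h1; exact: (entourage_split (phi t x)).
Qed.

Lemma spiral_semigroupP : holomorphic_semigroup phi.
Proof.
split.
- move=> t t0 z zd.
  have [l dl] := cdiff_to_strip zd.
  have [l' dl'] := cdiff_flow t0 (to_strip_strip zd).
  have [m dm] := cdiff_of_strip (flow_to_strip t0 zd).
  exact: cdiff_derivable (cdiff_comp (cdiff_comp dl dl') dm).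
- by move=> t z t0 zd; apply/of_strip_disc/flow_to_strip.
- by move=> z zd; rewrite /phi flow0 ?to_stripK//; exact: to_strip_strip.
- move=> s t z s0 t0 zd; rewrite {2}/phi to_strip_semigroup// -flowD//.
  exact: to_strip_strip.
- by move=> K cK KD t t0; exact: semigroup_uniform_cvg.
Qed.

Lemma of_strip_cvg1 (T : Type) (F : set_system T) {FF : Filter F} (u : T -> C) :
  (forall M, \forall x \near F, strip (u x) /\ M < Re (u x)) ->
  fmap (fun x => of_strip (u x)) F --> (1 : C).
Proof.
move=> hu; apply: cvgC_dist; apply: cvgR_dist => e e0.
have h := hu (ln (2 / e)); near=> x.
have [sx xM] : strip (u x) /\ ln (2 / e) < Re (u x) by near: x; exact: h.
rewrite sub0r normrN ger0_norm ?cmod_ge0//.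
apply: (le_lt_trans (cmod_one_sub_of_strip sx)).
rewrite expRN ltr_pdivrMr ?expR_gt0// mulrC -ltr_pdivrMr//.
by rewrite -[ltLHS]lnK ?posrE ?divr_gt0// ltr_expR.
Unshelve. all: by end_near. Qed.

Lemma spiral_denjoy_wolff : denjoy_wolff_point phi 1.
Proof.
split; first by rewrite normr1.
move=> z zd; apply: of_strip_cvg1 => M.
have h := flow_growth M (to_strip_strip zd); near=> t.
have [] : [/\ 0 <= t, strip (flow t (to_strip z)) & M < Re (flow t (to_strip z))].
  by near: t; exact: h.
by [].
Unshelve. all: by end_near. Qed.

Lemma stolzE (A : R) z : stolz 1 A z <-> cmod (1 - z) < A * (1 - cmod z).
Proof.
rewrite /stolz /= !normCE.
have -> : A%:C * (1 - (cmod z)%:C) = (A * (1 - cmod z))%:C.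
  by rewrite rmorphM rmorphB /= rmorph1.
by rewrite ltcR.
Qed.

Lemma stolz_disc (A : R) z : 0 < A -> stolz 1 A z -> unit_disc z.
Proof.
move=> A0 /stolzE h; apply/cmod_lt1; rewrite -subr_gt0 -(pmulr_rgt0 _ A0).
by apply: le_lt_trans h; exact: cmod_ge0.
Qed.

Lemma stolz_to_strip (A M : R) : 0 < A ->
  \forall z \near within (stolz (1 : C) A) (nbhs (1 : C)),
    unit_disc z /\ M < Re (to_strip z).
Proof.
move=> A0; have [d d0 h] := to_strip_large M.
have c : fmap (fun z : C => cmod (1 - z)) (nbhs (1 : C)) --> cmod (1 - 1 : C).
  apply: (cvg_comp _ _ _ (@cmod_cvg R (1 - 1))).
  by apply: cvgCB; [exact: cvgC_cst|exact: cvgC_id].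
rewrite subrr cmod0 in c.
have n := cvgR_lt c d0.
rewrite near_withinE; near=> z => sz; have zd := stolz_disc A0 sz.
by split=> //; apply: h => //; near: z; exact: n.
Unshelve. all: by end_near. Qed.

(** In the half-plane, 1 - z = 2 i / (zeta + i); so the difference quotient at 1
    only involves the quotient of the two values of zeta. *)
Lemma semigroup_slope t z : 0 <= t -> unit_disc z ->
  let q := I / cexp (to_strip z) in
  (phi t z - 1) / (z - 1) =
  (1 + q) / (cexp (flow t (to_strip z)) / cexp (to_strip z) + q).
Proof.
move=> t0 zd q; have sw := to_strip_strip zd; have sf := flow_to_strip t0 zd.
rewrite -{2}(to_stripK zd) -opprB -[of_strip (to_strip z) - 1]opprB.
rewrite !one_sub_of_strip /q.
have := upper_neqNI (cexp_Im_gt0 sw); have := upper_neqNI (cexp_Im_gt0 sf).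
have := I2_neq0 R; have := cexp_neq0 (to_strip z).
rewrite mulf_eq0 negb_or; move: (cexp (to_strip z)) (cexp (flow _ _)) I => a b i.
move=> a0 /andP[_ i0] b1 a1.
field.
by rewrite a0 a1 b1 i0.
Qed.

Lemma semigroup_slope_cvg (A : R) t : 0 < A -> 0 <= t ->
  fmap (fun z => (phi t z - 1) / (z - 1)) (within (stolz (1 : C) A) (nbhs (1 : C)))
    --> (1 : C).
Proof.
move=> A0 t0; set F := within _ _.
have FF : Filter F by exact: within_filter.
have hz M : \forall z \near F, unit_disc z /\ M < Re (to_strip z).
  exact: stolz_to_strip.
have hu M : \forall z \near F, strip (to_strip z) /\ M < Re (to_strip z).
  by apply: filterS (hz M) => z [/to_strip_strip].
have cr := flow_ratio_cvg t0 hu.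
have cq : fmap (fun z => I / cexp (to_strip z)) F --> (0 : C).
  apply: cvgC_cmod0; apply: cvgR_dist => e e0.
  apply: filterS (hu e^-1) => z [sz ez].
  rewrite sub0r normrN ger0_norm ?cmod_ge0// cmodM cmodV cmod_cexp.
  rewrite cmod_I.
  rewrite mul1r invf_plt ?posrE ?expR_gt0//.
  by apply: (lt_trans ez); apply: lt_le_trans (expR_ge1Dx _); rewrite ltrDr.
have e1 : (1 + 0) * (1 + 0)^-1 = 1 :> C by rewrite addr0 divr1.
have c3 : fmap (fun z => (1 + I / cexp (to_strip z)) *
    (cexp (flow t (to_strip z)) / cexp (to_strip z) +
     I / cexp (to_strip z))^-1) F --> (1 : C).
  rewrite -[X in _ --> X]e1; apply: cvgCM.
    by apply: cvgCD; [exact: cvgC_cst|exact: cq].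
  apply: cvgCV; first by rewrite addr0 oner_neq0.
  by apply: cvgCD; [exact: cr|exact: cq].
apply: cvgC_near_eq c3; apply: filterS (hz 0) => z [zd _].
by rewrite semigroup_slope.
Qed.

Lemma spiral_angular_derivative t : 0 <= t -> angular_derivative (phi t) 1 1.
Proof.
move=> t0; exists 1; split; move=> A A1; have A0 : 0 < A by apply: lt_trans A1.
  have c := semigroup_slope_cvg A0 t0.
  set F := within _ _ in c *.
  have FF : Filter F by exact: within_filter.
  have cz : fmap (fun z : C => z) F --> (1 : C) by exact: cvg_within.
  have e1 : 1 * (1 - 1) + 1 = 1 :> C by rewrite subrr mulr0 add0r.
  have c2 : fmap (fun z => (phi t z - 1) / (z - 1) * (z - 1) + 1) F --> (1 : C).
    rewrite -[X in _ --> X]e1; apply: cvgCD; last exact: cvgC_cst.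
    apply: cvgCM; first exact: c.
    by apply: cvgCB; [exact: cz|exact: cvgC_cst].
  apply: cvgC_near_eq c2; apply: filterS (stolz_to_strip 0 A0) => z [zd _].
  rewrite divfK ?subrK//.
  by rewrite -oppr_eq0 opprB disc_neq1.
exact: semigroup_slope_cvg.
Qed.

Lemma spiral_parabolic : parabolic_semigroup phi 1.
Proof.
split; last exact: spiral_angular_derivative.
split; [exact: spiral_semigroupP|exact: spiral_denjoy_wolff|exact: normr1].
Qed.

(** In the half-plane a Stolz region at the boundary point 1 lies in a sector
    |zeta| < 2 A Im zeta, and arg zeta is the imaginary part of w. *)
Lemma stolz_of_strip (A : R) w : 0 < A -> strip w -> stolz 1 A (of_strip w) ->
  1 < 2 * A * sin (Im w).
Proof.
move=> A0 sw hs; have z0 := cexp_Im_gt0 sw; have z1 := upper_neqNI z0.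
have /cmod_lt1 zd := of_strip_disc sw.
move: hs => /stolzE; rewrite one_sub_of_strip cmodM cmod2I cmodV => h.
have n0 : 0 < cmod (cexp w + I) by rewrite cmod_gt0.
have e := cmod_cayley_inv z1; rewrite -/(of_strip w) in e.
have hle := cmod_upperD z0; rewrite cmod_cexp in hle.
have r0 := cmod_ge0 (of_strip w).
set r := cmod (of_strip w) in h e zd r0.
set n := cmod (cexp w + I) in h e hle n0.
have E0 := expR_gt0 (Re w).
have ImE : Im (cexp w) = expR (Re w) * sin (Im w) by [].
rewrite ImE in e.
have sn : 0 < sin (Im w) by apply: sin_gt0_pi.
have h2 : 2 / n < A * (1 - r ^+ 2).
  by apply: (lt_le_trans h); rewrite ler_pM2l//; nra.
rewrite e in h2.
have h3 : 2 * n < A * (4 * (expR (Re w) * sin (Im w))).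
  have : 2 / n * n ^+ 2 < A * (4 * (expR (Re w) * sin (Im w)) / n ^+ 2) * n ^+ 2.
    by rewrite ltr_pM2r// exprn_gt0.
  have -> : 2 / n * n ^+ 2 = 2 * n by field; rewrite gt_eqF.
  by rewrite -[X in _ < X -> _]mulrA divfK// sqrf_eq0 gt_eqF.
have h4 : expR (Re w) * 1 < expR (Re w) * (2 * A * sin (Im w)) by lra.
by rewrite ltr_pM2l in h4.
Qed.

(** Along an orbit the imaginary part Y = exp m (m sin v + v cos v) of w exp w
    is constant. In a Stolz region sin v is bounded below, so the right-hand
    side would tend to +oo together with m. *)
Lemma spiral_tangential z : unit_disc z ->
  ~ converges_nontangentially (fun t => phi t z) 1.
Proof.
move=> zd [_ [A A1 hA]]; have A0 : 0 < A by apply: lt_trans A1.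
have sw := to_strip_strip zd.
set w := to_strip z in sw.
pose Y := Im (spiral w).
have h := flow_growth (2 * A * (`|Y| + 5)) sw.
near (pinfty_nbhs R) => t.
have [t0 sf mt] : [/\ 0 <= t, strip (flow t w) & 2 * A * (`|Y| + 5) < Re (flow t w)].
  by near: t; exact: h.
have st : stolz 1 A (phi t z) by near: t; exact: hA.
have sA := stolz_of_strip A0 sf st.
have [_ ef] := flowP t0 sw.
have eY : expR (Re (flow t w)) * (Re (flow t w) * sin (Im (flow t w)) +
    Im (flow t w) * cos (Im (flow t w))) = Y.
  have <- : Im (spiral (flow t w)) = Y by rewrite ef Im_subC.
  by case: (flow t w) => a b /=; ring.
move: sf mt sA eY => /andP[]; move: (Re _) (Im _) => m v v0 vpi mt sA eY.
have hc := cos_geN1 v.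
have pi4 := @pihalf_lt2 R.
have vc : - 4 <= v * cos v by nra.
have Y0 : 0 <= `|Y| by [].
have ms : `|Y| + 5 < m * sin v.
  have m0 : 0 < m by apply: le_lt_trans mt; rewrite mulr_ge0 ?addr_ge0 ?mulr_ge0// ltW.
  have A20 : 0 < 2 * A by rewrite mulr_gt0.
  rewrite -(ltr_pM2l A20); apply: (lt_trans mt).
  by rewrite mulrCA ltr_pMr.
have m0 : 0 <= m.
  by apply/ltW; apply: le_lt_trans mt; rewrite mulr_ge0 ?addr_ge0 ?mulr_ge0// ltW.
have E1 : 1 <= expR m by rewrite -expR0 ler_expR.
have := ler_norm Y; rewrite -{1}eY => hY.
nra.
Unshelve. all: by end_near. Qed.

Lemma spiral_koenigsP c : koenigs_function phi (spiral_koenigs c).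
Proof.
have I2 : I * I = -1 :> C by rewrite -expr2 sqr_i.
split.
- move=> z zd; have [l dl] := cdiff_to_strip zd.
  apply: cdiff_derivable; apply: cdiffZ; apply: cdiffD_cst.
  exact: cdiff_comp dl (cdiff_spiral _).
- move=> z z'; rewrite !inE => zd zd' e.
  have nI : - I != 0 :> C by rewrite oppr_eq0 eq_complex /= oner_eq0 andbF.
  have /addIr e' := mulfI nI e.
  rewrite -(to_stripK zd) -(to_stripK zd'); congr of_strip.
  by apply: spiral_inj e'; exact: to_strip_strip.
- move=> t z t0 zd; rewrite /spiral_koenigs to_strip_semigroup//.
  have [_ ->] := flowP t0 (to_strip_strip zd).
  by ring.
- apply: Or31; apply/seteqP; split=> // w _.
  pose v := I * w - c%:C.
  have [t t0 dt] := spiral_dom_down (Re v) (Im v).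
  exists t => //=.
  have dt' : spiral_dom (Re (v - t%:C)) (Im (v - t%:C)) by rewrite Re_subC Im_subC.
  have [u su uE] := spiral_surj dt'.
  exists (w + I * t%:C); last by rewrite addrK.
  exists (of_strip u); first exact: of_strip_disc.
  rewrite /spiral_koenigs of_stripK// uE /v.
  have -> : - I * (I * w - c%:C - t%:C + c%:C) = - (I * I) * w + I * t%:C by ring.
  by rewrite I2 opprK mul1r.
Qed.

Lemma Zset_sub_koenigs (alpha : R) : 1 < alpha ->
  exists c, Zset alpha `<=` spiral_koenigs c @` @unit_disc R.
Proof.
move=> a1; have [c hc] := spiral_dom_power a1; exists c => w /= hw.
have I2 : I * I = -1 :> C by rewrite -expr2 sqr_i.
have d : spiral_dom (Re (I * w - c%:C)) (Im (I * w - c%:C)).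
  have := hc _ _ hw; case: (w) => x y /=.
  by congr spiral_dom; ring.
have [u su uE] := spiral_surj d.
exists (of_strip u); first exact: of_strip_disc.
rewrite /spiral_koenigs of_stripK// uE.
have -> : - I * (I * w - c%:C + c%:C) = - (I * I) * w by ring.
by rewrite I2 opprK mul1r.
Qed.

End SpiralSemigroup.

Theorem proposition6p2 (R : realType) (alpha : R) (halpha : 1 < alpha) :
  exists (phi : R -> Cplx R -> Cplx R) (tau : Cplx R),
    [/\ parabolic_semigroup phi tau,
        forall z : Cplx R, unit_disc z ->
          ~ converges_nontangentially (fun t => phi t z) tau
      & exists2 h : Cplx R -> Cplx R,
          koenigs_function phi h & Zset alpha `<=` h @` @unit_disc R].
Proof.
have [c hc] := Zset_sub_koenigs halpha.
exists (@spiral_semigroup R), 1; split.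
- exact: spiral_parabolic.
- exact: spiral_tangential.
- exists (spiral_koenigs c) => //; exact: spiral_koenigsP.
Qed.
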